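(* Let $F:\mathcal{S}_n\to\mathbb{R}$ be of class $C^2$, quasiconcave, with $F(0)=0$, and uniformly elliptic in the sense that $\lambda|\xi|^2\leq F_{ij}(M)\xi_i\xi_j\leq\Lambda|\xi|^2$ for all $M\in\mathcal{S}_n$, $\xi\in\mathbb{R}^n$, where $0<\lambda\leq\Lambda$. Let $u\in C^2(B_1)$ satisfy $F(D^2u)=0$ in $B_1\subset\mathbb{R}^n$. Then \[ \|u\|_{C^{2,\alpha}(\overline{B}_{1/2})}\leq C, \] where $\alpha\in(0,1)$ depends only on $n,\lambda,\Lambda$, and $C$ depends on $n,\lambda,\Lambda$ and also on $\|u\|_{C^{1,1}(\overline{B}_{3/4})}$.
   Context: $\mathcal{S}_n$ denotes the space of real symmetric $n\times n$ matrices; $F_{ij}(M)=\partial F(M)/\partial m_{ij}$, with summation over repeated indices. $F$ is quasiconcave if all its superlevel sets $\{M\in\mathcal{S}_n: F(M)\geq a\}$, $a\in\mathbb{R}$, are convex, equivalently $F(\theta M_1+(1-\theta)M_2)\geq\min\{F(M_1),F(M_2)\}$ for all $M_1,M_2\in\mathcal{S}_n$, $\theta\in[0,1]$. $B_r$ is the ball of radius $r$ centered at $0$. *)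

(* Defs.v *)
From HB Require Import structures.
From mathcomp Require Import all_boot all_order all_algebra.
From mathcomp Require Import all_classical all_reals all_analysis.
Set Implicit Arguments. Unset Strict Implicit. Unset Printing Implicit Defensive.
Import Order.TTheory GRing.Theory Num.Theory.
Import numFieldNormedType.Exports.
Local Open Scope classical_set_scope.
Local Open Scope ring_scope.

Section Defs.
Variable R : realType.

Definition pd (p q : nat) (f : 'M[R]_(p, q) -> R) (i : 'I_p) (j : 'I_q)
  : 'M[R]_(p, q) -> R := fun x => 'D_(delta_mx i j) f x.

Definition C2_on (p q : nat) (U : set 'M[R]_(p, q)) (f : 'M[R]_(p, q) -> R) :=
  [/\ (forall x, U x -> differentiable f x),
      (forall i j x, U x -> differentiable (pd f i j) x) &
      (forall i j k l, {within U, continuous (pd (pd f i j) k l)})].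

Definition enorm2 (n : nat) (x : 'rV[R]_n) : R := \sum_i (x ord0 i) ^+ 2.
Definition enorm (n : nat) (x : 'rV[R]_n) : R := Num.sqrt (enorm2 x).
Definition eball (n : nat) (r : R) : set 'rV[R]_n := [set x | enorm x < r].
Definition cball (n : nat) (r : R) : set 'rV[R]_n := [set x | enorm x <= r].

Definition du (n : nat) (u : 'rV[R]_n -> R) (i : 'I_n) := pd u ord0 i.
Definition ddu (n : nat) (u : 'rV[R]_n -> R) (i j : 'I_n) := du (du u j) i.
Definition hess (n : nat) (u : 'rV[R]_n -> R) (x : 'rV[R]_n) : 'M[R]_n :=
  \matrix_(i, j) ddu u i j x.

Definition symmetric_mx (n : nat) (M : 'M[R]_n) := M^T = M.

(* the extension of F : S_n -> R to all matrices through the symmetric part;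
   F|S_n is C^k iff symmetrize F is C^k on 'M_n, and
   pd (symmetrize F) i j = F_ij with the usual symmetric convention *)
Definition symmetrize (n : nat) (F : 'M[R]_n -> R) : 'M[R]_n -> R :=
  fun M => F ((2%:R)^-1 *: (M + M^T)).

Definition quasiconcave (n : nat) (F : 'M[R]_n -> R) :=
  forall M1 M2 : 'M[R]_n, symmetric_mx M1 -> symmetric_mx M2 ->
  forall t : R, 0 <= t <= 1 ->
    Num.min (F M1) (F M2) <= F (t *: M1 + (1 - t) *: M2).

Definition unif_elliptic (n : nat) (lam Lam : R) (F : 'M[R]_n -> R) :=
  forall (M : 'M[R]_n) (xi : 'rV[R]_n), symmetric_mx M ->
    let q := \sum_i \sum_j pd (symmetrize F) i j M * xi ord0 i * xi ord0 j in
    lam * enorm2 xi <= q /\ q <= Lam * enorm2 xi.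

Definition C11_bound (n : nat) (u : 'rV[R]_n -> R) (A : set 'rV[R]_n) (K : R) :=
  [/\ (forall x, A x -> `|u x| <= K),
      (forall i x, A x -> `|du u i x| <= K) &
      (forall i x y, A x -> A y -> `|du u i x - du u i y| <= K * enorm (x - y))].

Definition C2alpha_bound (n : nat) (u : 'rV[R]_n -> R) (A : set 'rV[R]_n)
    (alpha C : R) :=
  [/\ (forall x, A x -> `|u x| <= C),
      (forall i x, A x -> `|du u i x| <= C),
      (forall i j x, A x -> `|ddu u i j x| <= C) &
      (forall i j x y, A x -> A y ->
         `|ddu u i j x - ddu u i j y| <= C * powR (enorm (x - y)) alpha)].

End Defs.

(* Main.v *)
(** Write [H] for the Hessian of [u] and [A x] for the gradient of [F] at
    [H x]. Quasiconcavity makes {F >= 0} convex, hence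
    [<A x, H y - H x> >= 0] for all [x], [y]; in particular every second
    difference quotient [v] of [u] satisfies [<A x, D^2 v> >= 0], a linear
    elliptic inequality with no control on the modulus of continuity of [A].

    The Krylov-Safonov weak Harnack inequality for the nonnegative supersolution
    [sup v - v] needs no Lebesgue measure: the size of a set is the proportion of
    small dyadic cells that it meets. Slopes are taken in a finite grid, each
    slope gives a contact point of the supersolution minus a polynomial barrier,
    a cell contains boundedly many contact points, and the Calderon-Zygmund lemma
    is an induction on the dyadic tree.

    Colour the Hessian values with finitely many colours. Some colour is
    popular; as long as the oscillation of [H] is not small, ellipticity gives a
    direction [e] in which the popular values lie well below the maximum of
    [u_ee], so by weak Harnack the values near this maximum disappear from a
    smaller cube. A colour is lost at each step, so after a bounded number of
    steps the oscillation has halved, and iteration gives the Holder bound. *)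
Require Import Defs.
From mathcomp Require Import all_boot all_order all_algebra.
From mathcomp Require Import all_classical all_reals all_analysis.
From mathcomp Require Import ring lra zify.
Set Implicit Arguments. Unset Strict Implicit. Unset Printing Implicit Defensive.
Import Order.TTheory GRing.Theory Num.Theory.
Import numFieldNormedType.Exports.
Local Open Scope classical_set_scope.
Local Open Scope ring_scope.

Section LinearAlgebra.
Variables (R : realType) (n : nat).
Implicit Types (A M N P : 'M[R]_n) (x y z : 'rV[R]_n).

Definition dot x y : R := (x *m y^T) ord0 ord0.
Definition bform A x y : R := dot (x *m A) y.
Definition qform A z : R := bform A z z.
Definition mxdot A N : R := \tr (A^T *m N).
Definition psd P := P^T = P /\ forall z, 0 <= qform P z.
Definition elliptic (lam Lam : R) A :=
  forall z, lam * enorm2 z <= qform A z <= Lam * enorm2 z.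

Lemma dotE x y : dot x y = \sum_i x ord0 i * y ord0 i.
Proof. by rewrite /dot mxE; apply: eq_bigr => i _; rewrite mxE. Qed.

Lemma dotC x y : dot x y = dot y x.
Proof. by rewrite !dotE; apply: eq_bigr => i _; rewrite mulrC. Qed.

Lemma dotDl x y z : dot (x + y) z = dot x z + dot y z.
Proof. by rewrite /dot mulmxDl mxE. Qed.

Lemma dotZl (a : R) x y : dot (a *: x) y = a * dot x y.
Proof. by rewrite /dot -scalemxAl mxE. Qed.

Lemma dotNl x y : dot (- x) y = - dot x y.
Proof. by rewrite -scaleN1r dotZl mulN1r. Qed.

Lemma dotDr x y z : dot z (x + y) = dot z x + dot z y.
Proof. by rewrite !(dotC z) dotDl. Qed.

Lemma dotZr (a : R) x y : dot y (a *: x) = a * dot y x.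
Proof. by rewrite !(dotC y) dotZl. Qed.

Lemma dotNr x y : dot y (- x) = - dot y x.
Proof. by rewrite !(dotC y) dotNl. Qed.

Lemma dot_delta x i : dot x (delta_mx ord0 i) = x ord0 i.
Proof. by rewrite /dot trmx_delta -colE mxE. Qed.

Lemma enorm2E x : enorm2 x = dot x x.
Proof. by rewrite dotE; apply: eq_bigr => i _; rewrite expr2. Qed.

Lemma enorm2_ge0 x : 0 <= enorm2 x.
Proof. by apply: sumr_ge0 => i _; exact: sqr_ge0. Qed.

Lemma enorm2_0 : enorm2 (0 : 'rV[R]_n) = 0.
Proof. by rewrite enorm2E /dot mul0mx mxE. Qed.

Lemma enorm2Z (a : R) x : enorm2 (a *: x) = a ^+ 2 * enorm2 x.
Proof. by rewrite !enorm2E dotZl dotZr mulrA expr2. Qed.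

Lemma enorm2N x : enorm2 (- x) = enorm2 x.
Proof. by rewrite -scaleN1r enorm2Z sqrrN expr1n mul1r. Qed.

Lemma enorm2D x y : enorm2 (x + y) = enorm2 x + 2 * dot x y + enorm2 y.
Proof. by rewrite !enorm2E !dotDl !dotDr (dotC y x); ring. Qed.

Lemma enorm2D_le x y : enorm2 (x + y) <= 2 * (enorm2 x + enorm2 y).
Proof. by have := enorm2_ge0 (x - y); rewrite !enorm2D enorm2N dotNr; lra. Qed.

Lemma coord_sqr_le_enorm2 x i : x ord0 i ^+ 2 <= enorm2 x.
Proof.
rewrite /enorm2 (bigD1 i) //= lerDl; apply: sumr_ge0 => j _; exact: sqr_ge0.
Qed.

Lemma enorm2_eq0 x : enorm2 x = 0 -> x = 0.
Proof.
move=> x0; apply/rowP => i; rewrite mxE; apply/eqP; rewrite -sqrf_eq0 eq_le sqr_ge0.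
by rewrite andbT -x0 coord_sqr_le_enorm2.
Qed.

Lemma mxdotE A N : mxdot A N = \sum_i \sum_j A i j * N i j.
Proof.
rewrite exchange_big; apply: eq_bigr => j _; rewrite mxE.
by apply: eq_bigr => i _; rewrite mxE.
Qed.

Lemma mxdotDr A M N : mxdot A (M + N) = mxdot A M + mxdot A N.
Proof. by rewrite /mxdot mulmxDr mxtraceD. Qed.

Lemma mxdotZr A (a : R) N : mxdot A (a *: N) = a * mxdot A N.
Proof. by rewrite /mxdot -scalemxAr mxtraceZ. Qed.

Lemma mxdotNr A N : mxdot A (- N) = - mxdot A N.
Proof. by rewrite -scaleN1r mxdotZr mulN1r. Qed.

Lemma mxdot_sumr A (I : Type) (s : seq I) (f : I -> 'M[R]_n) :
  mxdot A (\sum_(k <- s) f k) = \sum_(k <- s) mxdot A (f k).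
Proof. by rewrite /mxdot mulmx_sumr raddf_sum. Qed.

Lemma mxdot_scalar A (a : R) : mxdot A a%:M = a * \tr A.
Proof. by rewrite /mxdot mul_mx_scalar mxtraceZ mxtrace_tr. Qed.

Lemma bformE A x y : bform A x y = \sum_i \sum_j A i j * x ord0 i * y ord0 j.
Proof.
rewrite exchange_big /bform dotE; apply: eq_bigr => j _.
by rewrite mxE mulr_suml; apply: eq_bigr => i _; rewrite (mulrC (A i j)).
Qed.

Lemma bform_trmx A x y : bform A^T x y = bform A y x.
Proof.
rewrite !bformE exchange_big; apply: eq_bigr => i _; apply: eq_bigr => j _.
by rewrite mxE mulrAC.
Qed.

Lemma bform_delta A i x : bform A (delta_mx ord0 i) x = dot (row i A) x.
Proof. by rewrite /bform -rowE. Qed.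

Lemma bform_deltas A i j :
  bform A (delta_mx ord0 i) (delta_mx ord0 j) = A i j.
Proof. by rewrite bform_delta dot_delta mxE. Qed.

Lemma qformD A N z : qform (A + N) z = qform A z + qform N z.
Proof. by rewrite /qform /bform mulmxDr dotDl. Qed.

Lemma qformZ (a : R) A z : qform (a *: A) z = a * qform A z.
Proof. by rewrite /qform /bform -scalemxAr dotZl. Qed.

Lemma qformN A z : qform (- A) z = - qform A z.
Proof. by rewrite -scaleN1r qformZ mulN1r. Qed.

Lemma qform_sumr (I : Type) (s : seq I) (f : I -> 'M[R]_n) z :
  qform (\sum_(k <- s) f k) z = \sum_(k <- s) qform (f k) z.
Proof. by rewrite /qform /bform mulmx_sumr /dot mulmx_suml summxE. Qed.

Lemma qform_scalar (a : R) z : qform a%:M z = a * enorm2 z.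
Proof. by rewrite /qform /bform mul_mx_scalar dotZl enorm2E. Qed.

Lemma bform_outer x y z : bform (x^T *m x) y z = dot x y * dot x z.
Proof. by rewrite /bform mulmxA {1}/dot -mulmxA mxE big_ord1 (dotC x y). Qed.

Lemma qform_outer x z : qform (x^T *m x) z = dot x z ^+ 2.
Proof. by rewrite /qform bform_outer expr2. Qed.

Lemma mxdot_outer A x : mxdot A (x^T *m x) = qform A x.
Proof.
by rewrite /mxdot mulmxA mxtrace_mulC mulmxA trace_mx11; exact: bform_trmx.
Qed.

Lemma trace_outer x : \tr (x^T *m x) = enorm2 x.
Proof. by rewrite mxtrace_mulC trace_mx11 enorm2E. Qed.

Lemma qformZv (a : R) A z : qform A (a *: z) = a ^+ 2 * qform A z.
Proof. by rewrite /qform /bform -scalemxAl dotZl dotZr mulrA expr2. Qed.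

Lemma qformDv A x y : A^T = A ->
  qform A (x + y) = qform A x + 2 * bform A x y + qform A y.
Proof.
move=> symA; have bC : bform A y x = bform A x y by rewrite -bform_trmx symA.
rewrite /qform /bform mulmxDl !dotDl !dotDr -!/(bform _ _ _) bC; ring.
Qed.

Lemma psd_cauchy_schwarz P x y : psd P ->
  bform P x y ^+ 2 <= qform P x * qform P y.
Proof.
move=> [symP P_ge0]; pose p := Poly [:: qform P x; 2 * bform P x y; qform P y].
have p_ge0 (t : R) : 0 <= p.[t].
  have := P_ge0 (x + t *: y); rewrite qformDv// qformZv /bform dotZr -/(bform _ _ _).
  by rewrite horner_Poly /= mul0r add0r; congr (0 <= _); ring.
have := @deg_le2_poly_ge0 _ p (size_Poly _) p_ge0; rewrite /p !coefE /=; lra.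
Qed.

Lemma cauchy_schwarz x y : dot x y ^+ 2 <= enorm2 x * enorm2 y.
Proof.
have psd1 : psd 1%:M.
  by split=> [|z]; rewrite ?trmx1// qform_scalar mul1r enorm2_ge0.
by have := psd_cauchy_schwarz x y psd1; rewrite !qform_scalar !mul1r /bform mulmx1.
Qed.

Lemma psd_diag_ge0 P i : psd P -> 0 <= P i i.
Proof. by move=> [_ P_ge0]; rewrite -bform_deltas; exact: P_ge0. Qed.

Lemma psd_entry_sqr_le P i j : psd P -> P i j ^+ 2 <= P i i * P j j.
Proof.
move=> psdP; rewrite -!(bform_deltas P); exact: psd_cauchy_schwarz.
Qed.

Lemma psd_trace_ge0 P : psd P -> 0 <= \tr P.
Proof. by move=> psdP; apply: sumr_ge0 => i _; exact: psd_diag_ge0. Qed.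

Lemma psd_schur_complement P i : psd P -> 0 < P i i ->
  psd (P - (P i i)^-1 *: ((row i P)^T *m row i P)).
Proof.
move=> psdP Pii; have [symP _] := psdP; split.
  by rewrite raddfB /= linearZ /= trmx_mul trmxK symP.
move=> z; rewrite qformD qformN qformZ qform_outer subr_ge0 ler_pdivrMl//.
by rewrite -bform_delta -[P i i in leRHS]bform_deltas psd_cauchy_schwarz.
Qed.

(* Gaussian elimination: the Schur complement of [P i i] has one more zero on
   its diagonal. *)
Lemma psd_sum_outer P : psd P ->
  exists s : seq 'rV[R]_n, P = \sum_(x <- s) x^T *m x.
Proof.
have [k] := ubnP #|[pred i | P i i != 0]|; elim: k P => // k IH P rankP psdP.
have row_eq0 i j : P i i = 0 -> P i j = 0.
  move=> Pii; apply/eqP; rewrite -sqrf_eq0 eq_le sqr_ge0 andbT.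
  by have := psd_entry_sqr_le i j psdP; rewrite Pii mul0r.
have [i /= Pii|P0] := pickP [pred i | P i i != 0]; last first.
  exists [::]; rewrite big_nil; apply/matrixP => i j; rewrite mxE.
  exact/row_eq0/eqP/negbFE/P0.
have Pii_gt0 : 0 < P i i by rewrite lt0r Pii psd_diag_ge0.
have [|s sE] := IH _ _ (psd_schur_complement psdP Pii_gt0).
  rewrite ltnS in rankP; apply: leq_trans rankP; apply: proper_card.
  apply/properP; split; last first.
    exists i; rewrite inE//= !mxE big_ord1 !mxE mulrA mulVf// mul1r subrr.
    by rewrite negbK.
  apply/fintype.subsetP => j; rewrite !inE; apply: contra => /eqP Pjj.
  have Pij : P i j = 0 by have [symP _] := psdP; rewrite -symP mxE row_eq0.
  by rewrite !mxE big_ord1 !mxE Pij mul0r mulr0 subr0 Pjj.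
exists ((Num.sqrt (P i i))^-1 *: row i P :: s); rewrite big_cons -sE.
rewrite -scalemxAr [_^T]linearZ /= -scalemxAl scalerA -expr2 exprVn.
by rewrite sqr_sqrtr ?ltW// addrC subrK.
Qed.

Lemma elliptic_mxdot_psd (lam Lam : R) A P : elliptic lam Lam A -> psd P ->
  lam * \tr P <= mxdot A P.
Proof.
move=> ellA /psd_sum_outer[s ->]; rewrite mxdot_sumr raddf_sum mulr_sumr /=.
apply: ler_sum => x _; rewrite mxdot_outer trace_outer.
by have /andP[] := ellA x.
Qed.

Lemma psd_qform_le P z : psd P -> qform P z <= \tr P * enorm2 z.
Proof.
move=> /psd_sum_outer[s ->]; rewrite qform_sumr raddf_sum mulr_suml /=.
by apply: ler_sum => x _; rewrite qform_outer trace_outer cauchy_schwarz.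
Qed.

Lemma trace_elliptic_le (lam Lam : R) A : elliptic lam Lam A ->
  \tr A <= n%:R * Lam.
Proof.
move=> ellA; rewrite mulr_natl -[n in X in _ <= X]card_ord -sumr_const.
apply: ler_sum => i _; have /andP[_] := ellA (delta_mx ord0 i).
by rewrite /qform bform_deltas enorm2E dot_delta mxE !eqxx mulr1.
Qed.

End LinearAlgebra.

Section SupNorm.
Variable R : realType.

Lemma mx_coord_le_norm p q (M : 'M[R]_(p, q)) i j : `|M i j| <= `|M|.
Proof.
rewrite [leRHS]/Num.Def.normr /= mx_normrE; apply/bigmax_geP; right => /=.
by exists (i, j).
Qed.

Lemma mx_norm_le p q (M : 'M[R]_(p, q)) (a : R) :
  0 <= a -> (forall i j, `|M i j| <= a) -> `|M| <= a.
Proof.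
move=> a0 Ma; rewrite [leLHS]/Num.Def.normr /= mx_normrE.
by apply/bigmax_leP; split=> // -[i j] _; exact: Ma.
Qed.

Lemma mx_continuous (T : topologicalType) p q (f : T -> 'M[R]_(p, q)) (x : T) :
  (forall i j, {for x, continuous (fun y => f y i j)}) -> {for x, continuous f}.
Proof.
move=> cf; apply/cvgrPdist_le => e e0.
have entries : \forall y \near x, forall ij : 'I_p * 'I_q,
    `|f x ij.1 ij.2 - f y ij.1 ij.2| <= e.
  by apply: filter_forall => -[i j]; have /cvgrPdist_le := cf i j; exact.
apply: filterS entries => y fy; apply: mx_norm_le => [|i j]; first exact: ltW.
by rewrite !mxE; exact: (fy (i, j)).
Qed.

Variable n : nat.
Implicit Types (c x y z p : 'rV[R]_n) (M N : 'M[R]_n).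

Lemma norm_sqr_le_enorm2 x : `|x| ^+ 2 <= enorm2 x.
Proof.
rewrite -[leRHS]sqr_sqrtr ?enorm2_ge0// lerXn2r ?nnegrE ?sqrtr_ge0//.
apply: mx_norm_le => [|i j]; first exact: sqrtr_ge0.
rewrite ord1 -[leLHS]ger0_norm// -sqrtr_sqr ler_wsqrtr//.
by rewrite real_normK ?num_real// coord_sqr_le_enorm2.
Qed.

Lemma norm_le_enorm x : `|x| <= enorm x.
Proof.
rewrite -(@ler_pXn2r _ 2) ?nnegrE ?sqrtr_ge0// sqr_sqrtr ?enorm2_ge0//.
exact: norm_sqr_le_enorm2.
Qed.

Lemma enorm2_le_norm x : enorm2 x <= n%:R * `|x| ^+ 2.
Proof.
have <- : \sum_(i < n) `|x| ^+ 2 = n%:R * `|x| ^+ 2.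
  by rewrite sumr_const card_ord mulr_natl.
apply: ler_sum => i _.
by rewrite -real_normK ?num_real// lerXn2r ?nnegrE ?mx_coord_le_norm.
Qed.

Lemma enorm2_delta i : enorm2 (delta_mx ord0 i : 'rV[R]_n) = 1.
Proof. by rewrite enorm2E dot_delta mxE !eqxx. Qed.

Lemma norm_unit_le1 x : enorm2 x = 1 -> `|x| <= 1.
Proof.
move=> x1; rewrite -(@ler_pXn2r _ 2) ?nnegrE// expr1n -[leRHS]x1.
exact: norm_sqr_le_enorm2.
Qed.

Lemma qform_le_norm M z : `|qform M z| <= `|M| * n%:R * enorm2 z.
Proof.
pose a := map_mx Num.norm z.
have aE i : a ord0 i = `|z ord0 i| by rewrite mxE.
have a2 : enorm2 a = enorm2 z.
  by apply: eq_bigr => i _; rewrite aE real_normK ?num_real.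
have sum_a : (\sum_i a ord0 i) ^+ 2 <= n%:R * enorm2 z.
  have := cauchy_schwarz a (const_mx 1); rewrite dotE a2 mulrC.
  under eq_bigr do rewrite [const_mx _ _ _]mxE mulr1.
  move=> /le_trans; apply; rewrite ler_wpM2r ?enorm2_ge0// /enorm2.
  by under eq_bigr do rewrite mxE expr1n; rewrite sumr_const card_ord.
rewrite -mulrA; apply: le_trans (ler_wpM2l (normr_ge0 M) sum_a).
rewrite /qform bformE expr2 mulr_suml mulr_sumr.
apply: le_trans (ler_norm_sum _ _ _) _; apply: ler_sum => i _.
rewrite !mulr_sumr; apply: le_trans (ler_norm_sum _ _ _) _; apply: ler_sum => j _.
by rewrite !normrM !aE -mulrA ler_wpM2r ?mulr_ge0 ?mx_coord_le_norm.
Qed.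

Lemma qform_dist_le M N z (a : R) : enorm2 z = 1 -> `|M - N| <= a ->
  `|qform M z - qform N z| <= a * n%:R.
Proof.
move=> z1 MN; rewrite -qformN -qformD; apply: le_trans (qform_le_norm _ _) _.
by rewrite z1 mulr1 ler_wpM2r.
Qed.

Lemma psd_norm_le_trace M : psd M -> `|M| <= \tr M.
Proof.
move=> psdM; have tr_ge0 := psd_trace_ge0 psdM; apply: mx_norm_le => // i j.
have diag_le k : M k k <= \tr M.
  rewrite /mxtrace (bigD1 k) //= lerDl; apply: sumr_ge0 => l _.
  exact: psd_diag_ge0.
rewrite -(@ler_pXn2r _ 2) ?nnegrE// real_normK ?num_real//.
apply: le_trans (psd_entry_sqr_le i j psdM) _.
by rewrite expr2 ler_pM ?psd_diag_ge0.
Qed.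

(* If [qform N] were small on the whole unit sphere then [c%:M - N] would be
   positive semidefinite of small trace, hence [N] itself small. *)
Lemma elliptic_positive_direction (lam Lam : R) A N (c : R) :
  0 < lam -> elliptic lam Lam A -> N^T = N -> 0 <= mxdot A N -> 0 < c ->
  c * (1 + n%:R * Lam / lam) < `|N| ->
  exists2 e : 'rV[R]_n, enorm2 e = 1 & c <= qform N e.
Proof.
move=> lam_gt0 ellA symN AN c_gt0; apply: contraPP => no_dir; apply/negP; rewrite -leNgt.
have N_le z : qform N z <= c * enorm2 z.
  have [/enorm2_eq0->|z_neq0] := eqVneq (enorm2 z) 0.
    by rewrite enorm2_0 mulr0 -(scale0r 0) qformZv expr0n mul0r.
  have z_gt0 : 0 < enorm2 z by rewrite lt0r z_neq0 enorm2_ge0.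
  rewrite leNgt; apply/negP => Nz; apply: no_dir.
  have z2 : (Num.sqrt (enorm2 z))^-1 ^+ 2 = (enorm2 z)^-1.
    by rewrite exprVn sqr_sqrtr ?enorm2_ge0.
  exists ((Num.sqrt (enorm2 z))^-1 *: z); first by rewrite enorm2Z z2 mulVf.
  by rewrite qformZv z2 ler_pdivlMl// mulrC ltW.
have psdN : psd (c%:M - N).
  split=> [|z]; first by rewrite raddfB /= tr_scalar_mx symN.
  by rewrite qformD qformN qform_scalar subr_ge0.
have tr_le : \tr (c%:M - N) <= c * (n%:R * Lam) / lam.
  rewrite ler_pdivlMr// mulrC; apply: le_trans (elliptic_mxdot_psd ellA psdN) _.
  rewrite mxdotDr mxdotNr mxdot_scalar lerBlDr.
  by have := ler_wpM2l (ltW c_gt0) (trace_elliptic_le ellA); lra.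
have -> : c * (1 + n%:R * Lam / lam) = c + c * (n%:R * Lam) / lam by ring.
rewrite -[N](subKr c%:M); apply: le_trans (ler_normB _ _) (lerD _ _).
  apply: mx_norm_le => [|i j]; first exact: ltW.
  by rewrite mxE; case: eqP => _; rewrite ?mulr1n ?mulr0n ?normr0 ?gtr0_norm// ltW.
exact: le_trans (psd_norm_le_trace psdN) tr_le.
Qed.

Lemma enorm2_continuous : continuous (@enorm2 R n).
Proof.
apply: continuous_big => [|i _ x]; first exact: add_continuous.
exact: (continuous_comp (@coord_continuous R 1 n ord0 i x) (@exprn_continuous R 2 _)).
Qed.

Lemma dot_continuous p : continuous (dot p).
Proof.
rewrite (_ : dot p = fun x => \sum_i p ord0 i * x ord0 i); last exact/funext/dotE.
apply: continuous_big => [|i _ x]; first exact: add_continuous.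
exact: cvgMl_tmp (@coord_continuous R 1 n ord0 i x).
Qed.

Definition cube c (r : R) : set 'rV[R]_n := [set x | `|x - c| <= r].

Lemma cube_center c (r : R) : 0 <= r -> cube c r c.
Proof. by rewrite /cube /= subrr normr0. Qed.

Lemma cube_affine c x (r s : R) : 0 < r ->
  cube c (s * r) (c + r *: x) = cube 0 s x.
Proof.
move=> r0; rewrite /cube /= subr0 addrAC subrr add0r normrZ gtr0_norm//.
by rewrite mulrC ler_pM2r.
Qed.

Lemma affine_onto c x (r : R) : r != 0 -> exists y, c + r *: y = x.
Proof.
move=> r0; exists (r^-1 *: (x - c)).
by rewrite scalerA mulfV ?scale1r// addrC subrK.
Qed.

Lemma compact_cube c r : compact (cube c r).
Proof.
apply: bounded_closed_compact.
  exists (`|c| + r); split=> [|M cM x /= xc]; first exact: num_real.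
  apply: le_trans (ltW cM); rewrite -[x in leLHS](subrK c) addrC.
  by apply: le_trans (ler_normD _ _) _; rewrite lerD2l.
apply: (@preimage_closed _ _ (fun x => `|x - c|) [set a | a <= r]) => [x _|].
  apply: (@continuous_comp _ _ _ (fun y => y - c)); last exact: norm_continuous.
  exact: (cvgB cvg_id (cvg_cst _)).
exact: closed_le.
Qed.

Lemma compact_enorm2_le (a : R) : compact [set x : 'rV[R]_n | enorm2 x <= a].
Proof.
apply: subclosed_compact (@compact_cube 0 (1 + a)) _.
  apply: (@preimage_closed _ _ (@enorm2 R n) [set b | b <= a]) => [x _|].
    exact: enorm2_continuous.
  exact: closed_le.
move=> x /= xa; rewrite /cube /= subr0; have := le_trans (norm_sqr_le_enorm2 x) xa.
by have := sqr_ge0 (`|x| - 1); have := sqr_ge0 `|x|; lra.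
Qed.

End SupNorm.

Section UniformHessian.
Variables (R : realType) (n : nat).
Implicit Types (x y z : 'rV[R]_n) (u v : 'rV[R]_n -> R).
Implicit Types (H G : 'rV[R]_n -> 'M[R]_n) (D U : set 'rV[R]_n).

Definition second_diff (V : zmodType) (f : 'rV[R]_n -> V) x z : V :=
  f (x + z) + f (x - z) - f x *+ 2.

Definition unif_hessian D u H := forall e : R, 0 < e ->
  \forall z \near (0 : 'rV[R]_n), forall x, D x ->
    `|second_diff u x z - qform (H x) z| <= e * enorm2 z.

Lemma unif_hessian_sub D D' u H : D' `<=` D ->
  unif_hessian D u H -> unif_hessian D' u H.
Proof. by move=> D'D uH e /uH; apply: filterS => z uz x /D'D/uz. Qed.

Lemma unif_hessian_addc D u H (k : R) :
  unif_hessian D u H -> unif_hessian D (fun x => k + u x) H.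
Proof.
move=> uH e /uH; apply: filterS => z uz x /uz.
by congr (`|_ - _| <= _); rewrite /second_diff; ring.
Qed.

Lemma unif_hessianD D u v H G : unif_hessian D u H -> unif_hessian D v G ->
  unif_hessian D (fun x => u x + v x) (fun x => H x + G x).
Proof.
move=> uH vG e e0; have e2 : 0 < e / 2 by rewrite divr_gt0.
apply: filterS2 (uH _ e2) (vG _ e2) => z uz vz x Dx.
have -> : second_diff (fun x => u x + v x) x z - qform (H x + G x) z
    = (second_diff u x z - qform (H x) z) + (second_diff v x z - qform (G x) z).
  by rewrite qformD /second_diff; ring.
apply: le_trans (ler_normD _ _) _.
by rewrite [e]splitr mulrDl lerD ?uz ?vz.
Qed.

Lemma second_diffZ u (k : R) x z :
  second_diff (fun x => k * u x) x z = k * second_diff u x z.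
Proof. by rewrite /second_diff; ring. Qed.

Lemma unif_hessianZ D u H (k : R) :
  unif_hessian D u H -> unif_hessian D (fun x => k * u x) (fun x => k *: H x).
Proof.
move=> uH e e0; have k1 : 0 < `|k| + 1 by rewrite ltr_wpDl.
apply: filterS (uH _ (divr_gt0 e0 k1)) => z uz x Dx.
rewrite second_diffZ qformZ -mulrBr normrM; apply: le_trans (ler_wpM2l (normr_ge0 k) (uz x Dx)) _.
rewrite mulrA ler_wpM2r ?enorm2_ge0// mulrA ler_pdivrMr// mulrC.
by rewrite ler_wpM2l ?(ltW e0)// lerDl.
Qed.

Lemma second_diff_affine u y x z (s : R) :
  second_diff (fun x => u (y + s *: x)) x z = second_diff u (y + s *: x) (s *: z).
Proof. by rewrite /second_diff scalerDr scalerBr !addrA. Qed.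

Lemma unif_hessian_affine D D' u H y (s : R) :
  (forall x, D' x -> D (y + s *: x)) -> unif_hessian D u H ->
  unif_hessian D' (fun x => u (y + s *: x))
    (fun x => s ^+ 2 *: H (y + s *: x)).
Proof.
move=> D'D uH e e0; have s1 : 0 < s ^+ 2 + 1 by rewrite ltr_wpDl ?sqr_ge0.
have scale0 : s *: z @[z --> (0 : 'rV[R]_n)] --> (0 : 'rV[R]_n).
  by rewrite -[X in _ --> X](scaler0 _ s); exact: scaler_continuous.
have uHs : \forall z \near (0 : 'rV[R]_n), forall x, D x ->
    `|second_diff u x (s *: z) - qform (H x) (s *: z)|
      <= e / (s ^+ 2 + 1) * enorm2 (s *: z).
  exact: scale0 _ (uH _ (divr_gt0 e0 s1)).
apply: filterS uHs => z uz x /D'D Dx.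
rewrite second_diff_affine qformZ -qformZv; apply: le_trans (uz _ Dx) _.
rewrite enorm2Z mulrA ler_wpM2r ?enorm2_ge0// mulrAC ler_pdivrMr//.
by rewrite ler_wpM2l ?(ltW e0)// lerDl.
Qed.

Lemma second_diffC u x y z :
  second_diff (second_diff u ^~ y) x z = second_diff (second_diff u ^~ z) x y.
Proof.
rewrite /second_diff (addrAC x z y) (addrAC x z (- y)).
by rewrite (addrAC x (- z) y) (addrAC x (- z) (- y)); ring.
Qed.

Lemma qform_second_diff H x y z :
  qform (second_diff H x y) z = second_diff (fun x => qform (H x) z) x y.
Proof. by rewrite /second_diff !mulr2n !qformD qformN qformD. Qed.

Lemma unif_hessian_second_diff D D' u H y :
  (forall x, D' x -> [/\ D (x + y), D (x - y) & D x]) -> unif_hessian D u H ->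
  unif_hessian D' (second_diff u ^~ y) (second_diff H ^~ y).
Proof.
move=> D'D uH e e0; have e4 : 0 < e / 4 by rewrite divr_gt0.
apply: filterS (uH _ e4) => z uz x /D'D[/uz Dp /uz Dm /uz Dx].
rewrite second_diffC qform_second_diff /second_diff.
by move: Dp Dm Dx; rewrite !ler_norml /second_diff; lra.
Qed.

Lemma cvg_scale_right0 z : h *: z @[h --> (0 : R)^'+] --> (0 : 'rV[R]_n).
Proof.
rewrite -[X in _ --> X](scale0r z).
exact/cvg_at_right_filter/scalel_continuous.
Qed.

Lemma second_quotient_close D u H z (tau : R) : unif_hessian D u H -> 0 < tau ->
  \forall h \near (0 : R)^'+, forall x, D x ->
    `|second_diff u x (h *: z) / h ^+ 2 - qform (H x) z| <= tau.
Proof.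
move=> uH tau0; have z1 : 0 < enorm2 z + 1 by rewrite ltr_wpDl ?enorm2_ge0.
have hz0 := @cvg_scale_right0 z.
have uHz : \forall h \near (0 : R)^'+, forall x, D x ->
    `|second_diff u x (h *: z) - qform (H x) (h *: z)|
      <= tau / (enorm2 z + 1) * enorm2 (h *: z).
  exact: hz0 _ (uH _ (divr_gt0 tau0 z1)).
apply: filterS2 uHz (nbhs_right_gt 0) => h uHh h0 x /uHh.
have h2 : 0 < h ^+ 2 by rewrite exprn_gt0.
rewrite qformZv enorm2Z => le_tau.
have -> : second_diff u x (h *: z) / h ^+ 2 - qform (H x) z
    = (second_diff u x (h *: z) - h ^+ 2 * qform (H x) z) / h ^+ 2.
  by field; exact: lt0r_neq0.
rewrite normrM normfV (gtr0_norm h2) ler_pdivrMr//; apply: le_trans le_tau _.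
rewrite mulrCA mulrC ler_wpM2r ?(ltW h2)// mulrAC ler_pdivrMr//.
by rewrite ler_wpM2l ?(ltW tau0)// lerDl.
Qed.

Lemma unif_hessian_psd D u H x : unif_hessian D u H -> D x ->
  (H x)^T = H x -> (\forall z \near (0 : 'rV[R]_n), 0 <= second_diff u x z) ->
  psd (H x).
Proof.
move=> uH Dx symH min_x; split=> // z; apply/ler_addgt0Pr => tau tau0.
have hz0 := @cvg_scale_right0 z.
have min_xz : \forall h \near (0 : R)^'+, 0 <= second_diff u x (h *: z).
  exact: hz0 _ min_x.
have [h [/(_ x Dx) close sd_ge0]] :=
  filter_ex (filterI (second_quotient_close z uH tau0) min_xz).
have : 0 <= second_diff u x (h *: z) / h ^+ 2 by rewrite divr_ge0 ?sqr_ge0.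
by move: close; rewrite ler_norml; lra.
Qed.

Definition hessian_above D u H (eps delta : R) := forall x z, D x ->
  `|z| <= delta -> second_diff u x z <= qform (H x) z + eps * enorm2 z.

Lemma hessian_above_affine D D' u H y (s k eps delta : R) : 0 <= k -> 0 < s ->
  (forall x, D' x -> D (y + s *: x)) -> hessian_above D u H eps delta ->
  hessian_above D' (fun x => k * u (y + s *: x))
    (fun x => k *: (s ^+ 2 *: H (y + s *: x))) (k * s ^+ 2 * eps) (delta / s).
Proof.
move=> k0 s0 D'D above x z /D'D Dx; rewrite ler_pdivlMr// mulrC => z_le.
rewrite second_diffZ second_diff_affine !qformZ -qformZv.
have /(ler_wpM2l k0) : second_diff u (y + s *: x) (s *: z)
    <= qform (H (y + s *: x)) (s *: z) + eps * enorm2 (s *: z).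
  by apply: above; rewrite // normrZ gtr0_norm.
by rewrite enorm2Z; lra.
Qed.

Lemma hessian_above_le D u H (eps eps' delta : R) : eps <= eps' ->
  hessian_above D u H eps delta -> hessian_above D u H eps' delta.
Proof.
move=> le_eps above x z Dx zd; apply: le_trans (above x z Dx zd) _.
by rewrite lerD2l ler_wpM2r ?enorm2_ge0.
Qed.

Lemma unif_hessian_above D u H (eps : R) : unif_hessian D u H -> 0 < eps ->
  exists2 delta : R, 0 < delta & hessian_above D u H eps delta.
Proof.
move=> uH eps0; have /nbhs_normP[d /= d0 uHd] := uH _ eps0.
exists (d / 2) => [|x z Dx zd]; first by rewrite divr_gt0.
have zd' : `|0 - z| < d by rewrite sub0r normrN; apply: le_lt_trans zd _; lra.
by have := uHd _ zd' x Dx; rewrite ler_norml; lra.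
Qed.

Lemma near_pair_add x (P : set 'rV[R]_n) : (\forall y \near x, P y) ->
  \forall p \near (x, (0 : 'rV[R]_n)), P (p.1 + p.2).
Proof.
have := @add_continuous 'rV[R]_n (x, 0).
by rewrite /continuous_at /= addr0; apply.
Qed.

Lemma compact_unif_continuous (V : normedModType R) D (f : 'rV[R]_n -> V) :
  compact D -> (forall x, D x -> {for x, continuous f}) ->
  forall e : R, 0 < e ->
  \forall z \near (0 : 'rV[R]_n), forall x, D x -> `|f (x + z) - f x| <= e.
Proof.
move=> /compact_near_coveringP cptD cf e e0.
apply: (cptD _ (nbhs (0 : 'rV[R]_n)) (fun z x => `|f (x + z) - f x| <= e)).
move=> x Dx; have e2 : 0 < e / 2 by rewrite divr_gt0.
have /cvgrPdist_le/(_ _ e2) fx := cf x Dx.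
have fxz := near_pair_add fx.
near=> p; rewrite -(subrKA (f x)); apply: le_trans (ler_normD _ _) _.
rewrite [e]splitr lerD//; first by rewrite distrC; near: p.
by near: p; exact: (cvg_fst fx).
Unshelve. all: by end_near. Qed.

Lemma compact_near_shift D U : compact D -> open U -> D `<=` U ->
  \forall z \near (0 : 'rV[R]_n), forall x, D x -> U (x + z).
Proof.
move=> /compact_near_coveringP cptD openU DU.
apply: (cptD _ (nbhs (0 : 'rV[R]_n)) (fun z x => U (x + z))) => x /DU Ux.
exact: near_pair_add (open_nbhs_nbhs (conj openU Ux)).
Qed.

End UniformHessian.

Section DirectionalHessian.
Variables (R : realType) (n : nat).
Implicit Types (x y z a b : 'rV[R]_n) (u : 'rV[R]_n -> R).
Implicit Types (G : 'rV[R]_n -> 'rV[R]_n) (H : 'rV[R]_n -> 'M[R]_n).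

Definition has_hessian (U : set 'rV[R]_n) u G H := forall x, U x -> forall z,
  is_derive x z u (dot (G x) z) /\
  forall a, is_derive x z (fun y => dot (G y) a) (bform (H x) z a).

Lemma is_derive_line u x z (t du : R) : is_derive (x + t *: z) z u du ->
  is_derive t (1 : R) (fun s : R => u (x + s *: z)) du.
Proof.
move=> [der_u <-].
have quotientE : (fun h : R => h^-1 *: (u (x + (h *: (1 : R) + t) *: z) - u (x + t *: z)))
    = (fun h : R => h^-1 *: (u (h *: z + (x + t *: z)) - u (x + t *: z))).
  apply/funext => h; congr (_ *: (u _ - _)).
  by rewrite scalerDl addrCA -[h *: 1]/(h * 1) mulr1.
move: der_u; rewrite /derivable /= -quotientE => der.
by apply: (DeriveDef der); rewrite /derive /= -quotientE.
Qed.

Lemma MVT01 (g dg : R -> R) :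
  (forall t : R, 0 <= t <= 1 -> is_derive t (1 : R) g (dg t)) ->
  exists2 t, 0 <= t <= 1 & g 1 - g 0 = dg t.
Proof.
move=> der_g; have [||t] := @MVT R g dg 0 1 ltr01.
- by move=> t; rewrite in_itv /= => /andP[t0 t1]; apply: der_g; rewrite !ltW.
- by apply: derivable_within_continuous => t; rewrite in_itv /= => /der_g[].
- by rewrite in_itv /= subr0 mulr1 => /andP[t0 t1] ->; exists t; rewrite // !ltW.
Qed.

Lemma mixed_difference U u G H x a b : has_hessian U u G H ->
  (forall s t : R, 0 <= s <= 1 -> 0 <= t <= 1 -> U (x + s *: a + t *: b)) ->
  exists s t : R, [/\ 0 <= s <= 1, 0 <= t <= 1 &
    u (x + a + b) - u (x + a) - u (x + b) + u x
      = bform (H (x + s *: a + t *: b)) b a].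
Proof.
move=> uH inU; have i0 : 0 <= (0 : R) <= 1 by rewrite lexx ler01.
have i1 : 0 <= (1 : R) <= 1 by rewrite lexx ler01.
pose g (s : R) := u (x + b + s *: a) - u (x + s *: a).
have [s s01|s s01 gE] :=
    @MVT01 g (fun s => dot (G (x + b + s *: a)) a - dot (G (x + s *: a)) a).
  have [dx _] := uH _ (inU s 0 s01 i0) a; have [dxb _] := uH _ (inU s 1 s01 i1) a.
  rewrite scale0r addr0 in dx; rewrite scale1r addrAC in dxb.
  exact: is_deriveB (is_derive_line dxb) (is_derive_line dx).
have [t t01|t t01 kE] := @MVT01 (fun t => dot (G (x + s *: a + t *: b)) a)
    (fun t => bform (H (x + s *: a + t *: b)) b a).
  by have [_ dG] := uH _ (inU s t s01 t01) b; exact: is_derive_line.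
exists s, t; split=> //; rewrite -kE scale1r scale0r addr0 (addrAC x (s *: a)).
by rewrite -gE /g !scale1r !scale0r !addr0 (addrAC x b a); ring.
Qed.

Lemma second_diff_hessian U u G H x z : has_hessian U u G H ->
  (forall t : R, `|t| <= 1 -> U (x + t *: z)) ->
  exists2 t, `|t| <= 1 & second_diff u x z = qform (H (x + t *: z)) z.
Proof.
move=> uH seg.
have shiftE s t : x - z + s *: z + t *: z = x + (s + t - 1) *: z.
  by rewrite !scalerDl scaleN1r -!addrA; congr (_ + _); rewrite addrC addrA.
have st1 (s t : R) : 0 <= s <= 1 -> 0 <= t <= 1 -> `|s + t - 1| <= 1.
  by rewrite ler_norml; lra.
have [|s [t [s01 t01 diffE]]] := mixed_difference (x := x - z) (a := z) (b := z) uH.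
  by move=> s t s01 t01; rewrite shiftE; apply/seg/st1.
exists (s + t - 1); first exact: st1.
rewrite -shiftE -[RHS]diffE subrK /second_diff; ring.
Qed.

Lemma hessian_sym U u G H x : has_hessian U u G H -> open U -> U x ->
  {for x, continuous H} -> (H x)^T = H x.
Proof.
move=> uH openU Ux cH; apply/matrixP => i j; rewrite mxE; apply/eqP.
rewrite -subr_eq0 -normr_le0; apply/ler_addgt0Pl => e e0; rewrite addr0.
have e2 : 0 < e / 2 by rewrite divr_gt0.
move/cvgrPdist_le: cH => /(_ _ e2) cH.
have /nbhs_normP[d /= d0 near_x] : \forall y \near x, U y /\ `|H x - H y| <= e / 2.
  by apply: filterI cH; exact: open_nbhs_nbhs.
pose k := d / 3; have k0 : 0 < k by rewrite divr_gt0.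
pose v l : 'rV[R]_n := k *: delta_mx ord0 l.
have v_le l : `|v l| <= k.
  rewrite normrZ gtr0_norm// ler_piMr ?(ltW k0)//.
  by rewrite norm_unit_le1 ?enorm2_delta.
have close l m (s t : R) : 0 <= s <= 1 -> 0 <= t <= 1 ->
    U (x + s *: v l + t *: v m) /\ `|H x - H (x + s *: v l + t *: v m)| <= e / 2.
  move=> s01 t01; apply: near_x; rewrite /= -addrA opprD addrA subrr sub0r normrN.
  have scaled_le (r : R) p : 0 <= r <= 1 -> `|r *: v p| <= k.
    move=> /andP[r0 r1]; rewrite normrZ ger0_norm//; apply: le_trans (v_le p).
    by rewrite ler_piMl.
  have := ler_normD (s *: v l) (t *: v m).
  by have := scaled_le s l s01; have := scaled_le t m t01; rewrite /k; lra.
have bformE l m y : bform (H y) (v m) (v l) = k ^+ 2 * H y m l.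
  by rewrite /bform -scalemxAl dotZl dotZr -/(bform _ _ _) bform_deltas mulrA expr2.
have [s [t [s01 t01 diffE]]] :=
  mixed_difference uH (fun s t s01 t01 => (close i j s t s01 t01).1).
have [s' [t' [s01' t01' diffE']]] :=
  mixed_difference uH (fun s t s01 t01 => (close j i s t s01 t01).1).
have kH : k ^+ 2 * H (x + s *: v i + t *: v j) j i
    = k ^+ 2 * H (x + s' *: v j + t' *: v i) i j.
  by rewrite -!bformE -diffE -diffE' (addrAC x (v j)); ring.
have {kH} entryE := mulfI (lt0r_neq0 (exprn_gt0 2 k0)) kH.
have := le_trans (mx_coord_le_norm _ j i) (close i j s t s01 t01).2.
have := le_trans (mx_coord_le_norm _ i j) (close j i s' t' s01' t01').2.
by rewrite !mxE entryE !ler_norml; lra.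
Qed.

Lemma has_hessian_unif U D u G H : has_hessian U u G H -> open U ->
  compact D -> D `<=` U -> (forall x, D x -> {for x, continuous H}) ->
  unif_hessian D u H.
Proof.
move=> uH openU cptD DU cH e e0; have n1 : 0 < n%:R + 1 :> R by rewrite ltr_wpDl.
have /nbhs_normP[d /= d0 dP] : \forall z \near (0 : 'rV[R]_n),
    (forall x, D x -> U (x + z)) /\
    forall x, D x -> `|H (x + z) - H x| <= e / (n%:R + 1).
  apply: filterI; first exact: compact_near_shift.
  exact: compact_unif_continuous (divr_gt0 e0 n1).
apply/nbhs_normP; exists d => // z /=; rewrite sub0r normrN => zd x Dx.
have small t : `|t| <= 1 -> `|0 - t *: z| < d.
  by move=> t1; rewrite sub0r normrN normrZ; apply: le_lt_trans zd; rewrite ler_piMl.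
have [|t t1 ->] := @second_diff_hessian U u G H x z uH.
  by move=> t /small/dP[inUz _]; exact: inUz.
have /dP[_ /(_ x Dx) Hxt] := small _ t1.
rewrite -qformN -qformD; apply: le_trans (qform_le_norm _ _) _.
rewrite ler_wpM2r ?enorm2_ge0//; apply: le_trans (ler_wpM2r _ Hxt) _ => //.
by rewrite mulrAC ler_pdivrMr// ler_wpM2l ?(ltW e0)// lerDl.
Qed.

End DirectionalHessian.

Section Barrier.
Variables (R : realType) (n : nat) (rho : R) (m : nat).
Hypothesis rho_gt0 : 0 < rho.
Implicit Types (x y z a : 'rV[R]_n).

Definition cap x : R := 1 - enorm2 x / rho.
Definition barrier x : R := cap x ^+ m.+2.
Definition barrier_grad x : 'rV[R]_n :=
  (- (2 * m.+2%:R * cap x ^+ m.+1 / rho)) *: x.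
Definition barrier_hess x : 'M[R]_n :=
  (- (2 * m.+2%:R * cap x ^+ m.+1 / rho))%:M
  + (4 * (m.+2 * m.+1)%:R * cap x ^+ m / rho ^+ 2) *: (x^T *m x).

Lemma cap_le1 x : cap x <= 1.
Proof. by rewrite gerBl divr_ge0 ?enorm2_ge0// ltW. Qed.

Lemma cap_ge0 x : enorm2 x <= rho -> 0 <= cap x.
Proof. by rewrite subr_ge0 ler_pdivrMr// mul1r. Qed.

Lemma cap_exp_itv x k : enorm2 x <= rho -> 0 <= cap x ^+ k <= 1.
Proof. by move=> /cap_ge0 cap0; rewrite exprn_ge0//= exprn_ile1// cap_le1. Qed.

Lemma is_derive_dotl x z a : is_derive x z (fun y => dot y a) (dot z a).
Proof.
have cvg_quotient :
    h^-1 *: (dot (h *: z + x) a - dot x a) @[h --> (0 : R)^'] --> dot z a.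
  apply: cvg_near_cst; near=> h; rewrite dotDl dotZl addrK -[LHS]/(_ * _) mulKf//.
  by near: h; exact: nbhs_dnbhs_neq.
by apply: DeriveDef; [apply/cvg_ex; exists (dot z a)|exact: cvg_lim].
Unshelve. all: by end_near. Qed.

Lemma is_derive_enorm2 x z : is_derive x z (@enorm2 R n) (2 * dot x z).
Proof.
have -> : @enorm2 R n = \sum_(i < n) (fun y => dot y (delta_mx ord0 i)) ^+ 2.
  by apply/funext => y; rewrite fct_sumE; apply: eq_bigr => i _; rewrite -dot_delta.
have der_coord i := is_derive_dotl x z (delta_mx ord0 i).
apply: is_derive_eq; rewrite dotE mulr_sumr; apply: eq_bigr => i _.
by rewrite !dot_delta expr1 -[LHS]/(_ * _) mulrA.
Qed.

Lemma is_derive_cap x z : is_derive x z cap (- (2 * dot x z / rho)).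
Proof.
have der_enorm2 := is_derive_enorm2 x z.
have -> : cap = cst 1 - rho^-1 *: @enorm2 R n.
  by apply/funext => y; rewrite /cap mulrC.
by apply: is_derive_eq; rewrite sub0r [in RHS]mulrC.
Qed.

Lemma is_derive_cap_exp x z k : is_derive x z (fun y => cap y ^+ k.+1)
  (- (2 * k.+1%:R * cap x ^+ k / rho * dot x z)).
Proof.
have der_cap := is_derive_cap x z.
have -> : (fun y => cap y ^+ k.+1) = cap ^+ k.+1 by rewrite exprfctE.
by apply: is_derive_eq; rewrite -[LHS]/(_ * _); ring.
Qed.

Lemma barrier_has_hessian : has_hessian setT barrier barrier_grad barrier_hess.
Proof.
move=> x _ z; split=> [|a].
  by apply: is_derive_eq (is_derive_cap_exp x z m.+1) _; rewrite dotZl; ring.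
have der_cap := is_derive_cap_exp x z m; have der_dot := is_derive_dotl x z a.
have -> : (fun y => dot (barrier_grad y) a) =
    (- (2 * m.+2%:R / rho)) *: ((fun y => cap y ^+ m.+1) * (fun y => dot y a)).
  by apply/funext => y; rewrite dotZl -[RHS]/(_ * (_ * _)); ring.
apply: is_derive_eq; rewrite -![_ *: _]/(_ * _) /bform /barrier_hess mulmxDr.
rewrite dotDl mul_mx_scalar -scalemxAr !dotZl -/(bform _ z a) bform_outer natrM.
rewrite (dotC x z) (dotC x a); field; exact: lt0r_neq0.
Qed.

Lemma cap_continuous : continuous cap.
Proof.
move=> x; have scaled : {for x, continuous (fun y => enorm2 y / rho)}.
  exact: cvgMr_tmp (@enorm2_continuous R n x).
exact: (@continuousB _ R^o _ (cst 1) _ x (@cst_continuous _ _ _ x) scaled).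
Qed.

Lemma cap_exp_continuous k : continuous (fun x => cap x ^+ k).
Proof.
move=> x.
exact: (@continuous_comp _ _ _ cap (fun r : R => r ^+ k) x (@cap_continuous x)
  (@exprn_continuous R k _)).
Qed.

Lemma barrier_hess_continuous x : {for x, continuous barrier_hess}.
Proof.
have cap_exp k := @cap_exp_continuous k x; apply: mx_continuous => i j.
have -> : (fun y => barrier_hess y i j) = fun y =>
    - (2 * m.+2%:R * cap y ^+ m.+1 / rho) * (i == j)%:R +
    4 * (m.+2 * m.+1)%:R * cap y ^+ m / rho ^+ 2 * (y ord0 i * y ord0 j).
  by apply/funext => y; rewrite !mxE big_ord1 !mxE [X in _ = X + _]mulr_natr.
have diag : {for x, continuous (fun y =>
    - (2 * m.+2%:R * cap y ^+ m.+1 / rho) * (i == j)%:R)}.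
  exact: cvgMr_tmp (cvgN (cvgMr_tmp (cvgMl_tmp (cap_exp m.+1)))).
have outer : {for x, continuous (fun y =>
    4 * (m.+2 * m.+1)%:R * cap y ^+ m / rho ^+ 2 * (y ord0 i * y ord0 j))}.
  have coord k : {for x, continuous (fun y => y ord0 k)} by exact: coord_continuous.
  exact: cvgM (cvgMr_tmp (cvgMl_tmp (cap_exp m))) (cvgM (coord i) (coord j)).
exact: cvgD diag outer.
Qed.

Lemma barrier_hess_sym x : (barrier_hess x)^T = barrier_hess x.
Proof.
by rewrite /barrier_hess raddfD /= tr_scalar_mx [X in _ + X]linearZ /= trmx_mul trmxK.
Qed.

Lemma qform_barrier_hess x z : qform (barrier_hess x) z
  = - (2 * m.+2%:R * cap x ^+ m.+1 / rho) * enorm2 z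
    + 4 * (m.+2 * m.+1)%:R * cap x ^+ m / rho ^+ 2 * dot x z ^+ 2.
Proof. by rewrite qformD qform_scalar qformZ qform_outer. Qed.

Lemma mxdot_barrier_hess (A : 'M[R]_n) x : mxdot A (barrier_hess x)
  = - (2 * m.+2%:R * cap x ^+ m.+1 / rho) * \tr A
    + 4 * (m.+2 * m.+1)%:R * cap x ^+ m / rho ^+ 2 * qform A x.
Proof. by rewrite mxdotDr mxdot_scalar mxdotZr mxdot_outer. Qed.

Lemma qform_barrier_hess_ge x z : enorm2 x <= rho ->
  - (2 * m.+2%:R / rho) * enorm2 z <= qform (barrier_hess x) z.
Proof.
move=> xrho; rewrite qform_barrier_hess; apply: ler_wpDr.
  by rewrite mulr_ge0 ?sqr_ge0// !mulr_ge0 ?invr_ge0 ?sqr_ge0 ?exprn_ge0 ?cap_ge0.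
rewrite ler_wpM2r ?enorm2_ge0// lerN2 mulrAC ler_piMr ?divr_ge0 ?(ltW rho_gt0)//.
by have /andP[] := cap_exp_itv m.+1 xrho.
Qed.

Lemma qform_barrier_hess_le x z : enorm2 x <= rho ->
  qform (barrier_hess x) z <= 4 * (m.+2 * m.+1)%:R / rho * enorm2 z.
Proof.
move=> xrho; rewrite qform_barrier_hess; apply: ler_wnDl.
  rewrite mulNr oppr_le0 !mulr_ge0 ?invr_ge0 ?(ltW rho_gt0) ?enorm2_ge0//.
  by rewrite exprn_ge0// cap_ge0.
have -> : 4 * (m.+2 * m.+1)%:R * cap x ^+ m / rho ^+ 2 * dot x z ^+ 2
    = 4 * (m.+2 * m.+1)%:R / rho * (cap x ^+ m * (dot x z ^+ 2 / rho)).
  by field; exact: lt0r_neq0.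
rewrite ler_wpM2l ?divr_ge0 ?mulr_ge0 ?(ltW rho_gt0)//.
have /andP[b0 b1] := cap_exp_itv m xrho.
have xz : dot x z ^+ 2 / rho <= enorm2 z.
  rewrite ler_pdivrMr// mulrC; apply: le_trans (cauchy_schwarz _ _) _.
  by rewrite ler_wpM2r ?enorm2_ge0.
by apply: le_trans xz; rewrite ler_piMl// divr_ge0 ?sqr_ge0// ltW.
Qed.

Lemma enorm2_segment_le x z (t a : R) : `|t| <= 1 ->
  enorm2 (x + z) <= a -> enorm2 (x - z) <= a -> enorm2 (x + t *: z) <= a.
Proof.
rewrite !enorm2D enorm2N enorm2Z dotNr dotZr ler_norml => /andP[t_ge t_le] xpz xmz.
have z0 := enorm2_ge0 z.
have tp : 0 <= (1 + t) / 2 by lra.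
have tm : 0 <= (1 - t) / 2 by lra.
have := ler_wpM2l tp xpz; have := ler_wpM2l tm xmz.
by have := mulr_ge0 (mulr_ge0 tp tm) z0; lra.
Qed.

Lemma second_diff_barrier_ge x z : enorm2 (x + z) <= rho -> enorm2 (x - z) <= rho ->
  - (2 * m.+2%:R / rho) * enorm2 z <= second_diff barrier x z.
Proof.
move=> xpz xmz; have [//|t t1 ->] := second_diff_hessian (x := x) (z := z) barrier_has_hessian.
by apply: qform_barrier_hess_ge; exact: enorm2_segment_le.
Qed.

Lemma barrier_unif_hessian (D : set 'rV[R]_n) :
  compact D -> unif_hessian D barrier barrier_hess.
Proof.
move=> cptD; exact: (has_hessian_unif barrier_has_hessian openT cptD (@subsetT _ D)
  (fun x _ => @barrier_hess_continuous x)).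
Qed.

End Barrier.

Section DyadicDensity.
Variables (R : realType) (n : nat).
Implicit Types (a c x : 'rV[R]_n) (s h : R) (b : {ffun 'I_n -> bool}).
Implicit Types P Q : 'rV[R]_n -> R -> bool.

Definition subcube a s c h : bool := `|a - c| + s <= h.

Definition child c h b : 'rV[R]_n :=
  c + \row_i (if b i then h / 2 else - (h / 2)).

(* The proportion, among the dyadic subcubes of generation [j] of [cube c h],
   of those whose centre and half-side satisfy [P]. *)
Fixpoint dens P (j : nat) c h : R :=
  if j is k.+1
  then (2 ^+ n)^-1 * \sum_(b : {ffun 'I_n -> bool}) dens P k (child c h b) (h / 2)
  else (P c h)%:R.

Lemma subcube_sub a s c h : subcube a s c h -> cube a s `<=` cube c h.
Proof.
move=> ac x /= xa; apply: le_trans ac; rewrite -(subrKA a) addrC.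
by apply: le_trans (ler_normD _ _) _; rewrite lerD2l.
Qed.

Lemma child_dist c h b : 0 <= h -> `|child c h b - c| <= h / 2.
Proof.
move=> h0; have h2 : 0 <= h / 2 by rewrite divr_ge0.
apply: mx_norm_le => // i j; rewrite /child addrAC subrr add0r mxE.
by case: ifP => _; rewrite ?normrN ger0_norm.
Qed.

Lemma subcube_child a s c h b : 0 <= h ->
  subcube a s (child c h b) (h / 2) -> subcube a s c h.
Proof.
move=> /(child_dist c b); rewrite /subcube -[a - c](subrKA (child c h b)).
by have := ler_normD (a - child c h b) (child c h b - c); lra.
Qed.

Lemma child_cover c h x : 0 <= h -> cube c h x ->
  exists b, cube (child c h b) (h / 2) x.
Proof.
move=> h0 xc; exists [ffun i => 0 <= (x - c) ord0 i].
apply: mx_norm_le => [|o i]; rewrite ?divr_ge0// /child opprD addrA (ord1 o).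
have := le_trans (mx_coord_le_norm _ ord0 i) xc.
move: (x - c) => y; rewrite 2!mxE [X in y _ _ - X]mxE ffunE.
case: ifP => [y0|/negbT]; first by rewrite ger0_norm// ler_norml; lra.
by rewrite -ltNge => y0; rewrite ltr0_norm// ler_norml; lra.
Qed.

Lemma child_affine a c (r : R) s b :
  a + r *: child c s b = child (a + r *: c) (r * s) b.
Proof.
rewrite /child scalerDr addrA; congr (_ + _); apply/rowP => i; rewrite !mxE.
by case: ifP => _; rewrite ?mulrN mulrA.
Qed.

Lemma card_children : #|{ffun 'I_n -> bool}|%:R = 2 ^+ n :> R.
Proof. by rewrite card_ffun card_bool card_ord natrX. Qed.

Let cells_gt0 : 0 < 2 ^+ n :> R. Proof. exact: exprn_gt0. Qed.

Lemma dens_ge0 P j c h : 0 <= dens P j c h.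
Proof.
elim: j c h => [|j IH] c h /=; first exact: ler0n.
by rewrite mulr_ge0 ?invr_ge0 ?(ltW cells_gt0)// sumr_ge0.
Qed.

Lemma densC P j c h : dens (fun a s => ~~ P a s) j c h = 1 - dens P j c h.
Proof.
elim: j c h => [|j IH] c h /=; first by case: (P c h); rewrite ?subrr ?subr0.
under eq_bigr do rewrite IH.
rewrite big_split /= sumrN sumr_const card_children mulrDr mulrN.
by rewrite mulVf// lt0r_neq0.
Qed.

Lemma dens_affine P j a (r : R) c h :
  dens (fun x s => P (a + r *: x) (r * s)) j c h = dens P j (a + r *: c) (r * h).
Proof.
elim: j c h => [//|j IH] c h /=; congr (_ * _); apply: eq_bigr => b _.
by rewrite IH child_affine mulrA.
Qed.

Lemma dens_le P Q j c h : 0 <= h ->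
  (forall a, subcube a (h / 2 ^+ j) c h -> P a (h / 2 ^+ j) -> Q a (h / 2 ^+ j)) ->
  dens P j c h <= dens Q j c h.
Proof.
elim: j c h => [|j IH] c h h0 PQ /=.
  have := PQ c; rewrite /subcube expr0 divr1 subrr normr0 add0r => /(_ (lexx _)).
  by case: (P c h) => // ->.
rewrite ler_wpM2l ?invr_ge0 ?(ltW cells_gt0)//; apply: ler_sum => b _.
apply: IH => [|a ac]; first by rewrite divr_ge0.
by have := PQ a; rewrite exprS invfM mulrA; apply; exact: subcube_child ac.
Qed.

Lemma dens_eq1 P j c h : 0 <= h ->
  (forall a, subcube a (h / 2 ^+ j) c h -> P a (h / 2 ^+ j)) -> dens P j c h = 1.
Proof.
move=> h0 allP; have := dens_ge0 (fun a s => ~~ P a s) j c h.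
have : dens (fun a s => ~~ P a s) j c h <= dens (fun _ _ => false) j c h.
  by apply: dens_le => // a /allP ->.
have -> : dens (fun _ _ => false) j c h = 0.
  by elim: j c h {h0 allP} => //= j IH c h; rewrite big1 ?mulr0.
by rewrite densC; lra.
Qed.

Lemma dens_gt0_ex P j c h : 0 <= h -> 0 < dens P j c h ->
  exists2 a, subcube a (h / 2 ^+ j) c h & P a (h / 2 ^+ j).
Proof.
move=> h0; apply: contraPP => noP; apply/negP; rewrite -leNgt -(subKr 1 (dens _ _ _ _)).
rewrite -densC dens_eq1 ?subrr// => a ac; apply/negP => Pa; apply: noP.
by exists a.
Qed.

Lemma dens_sum_ge1 (I : finType) (P : I -> 'rV[R]_n -> R -> bool) j c h :
  (forall a s, exists i, P i a s) -> 1 <= \sum_i dens (P i) j c h.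
Proof.
move=> exP; elim: j c h => [|j IH] c h /=.
  have [i Pi] := exP c h; rewrite (bigD1 i) //= Pi lerDl.
  by apply: sumr_ge0 => ? _; exact: ler0n.
rewrite -mulr_sumr exchange_big /= mulrC ler_pdivlMr// mul1r -card_children.
rewrite -sum1_card natr_sum; apply: ler_sum => b _; exact: IH.
Qed.

Lemma popular_color (T : finType) (col : 'rV[R]_n -> T) j c h :
  exists k, #|T|%:R^-1 <= dens (fun a _ => col a == k) j c h.
Proof.
apply: contrapT => unpopular.
have T_gt0 : 0 < #|T|%:R :> R by rewrite ltr0n; apply/card_gt0P; exists (col 0).
have : 1 <= \sum_k dens (fun a _ => col a == k) j c h.
  by apply: dens_sum_ge1 => a _; exists (col a).
apply/negP; rewrite -ltNge.
have -> : 1 = \sum_(k : T) #|T|%:R^-1 :> R.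
  by rewrite sumr_const -[RHS]mulr_natl mulfV// lt0r_neq0.
apply: ltr_sum => [|k _]; first by apply/hasP; exists (col 0).
by rewrite ltNge; apply/negP => ?; apply: unpopular; exists k.
Qed.

Lemma size_le_dens P (N j : nat) c h (pts : seq 'rV[R]_n) : 0 <= h ->
  {in pts, forall p, cube c h p} ->
  {in pts, forall p a, `|p - a| <= h / 2 ^+ j -> P a (h / 2 ^+ j)} ->
  (forall a, (count (fun p => `|p - a| <= h / 2 ^+ j)%R pts <= N)%N) ->
  (size pts)%:R <= N%:R * (2 ^+ n) ^+ j * dens P j c h.
Proof.
elim: j c h pts => [|j IH] c h pts h0 in_c meetP countN.
  rewrite expr0 mulr1 /=; move: meetP countN; rewrite expr0 divr1.
  case: pts in_c => [|p pts] in_c meetP countN; first by rewrite !mulr_ge0.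
  rewrite (meetP p) ?mem_head ?in_c ?mem_head// mulr1 ler_nat.
  apply: leq_trans (countN c); rewrite -size_filter.
  by rewrite (_ : seq.filter _ _ = p :: pts)//; apply/all_filterP/allP.
have hE : h / 2 ^+ j.+1 = h / 2 / 2 ^+ j by rewrite exprS invfM mulrA.
rewrite hE in meetP countN; have h2 : 0 <= h / 2 by rewrite divr_ge0.
pose in_child b := [seq p <- pts | `|p - child c h b| <= h / 2].
have child_le b : (size (in_child b))%:R
    <= N%:R * (2 ^+ n) ^+ j * dens P j (child c h b) (h / 2).
  apply: IH => // [p|p|a]; rewrite ?mem_filter; first by case/andP.
  - by case/andP=> _; exact: meetP.
  - apply: leq_trans (countN a); rewrite count_filter.
    by apply: sub_count => p /andP[].
have : (size pts)%:R <= \sum_b (size (in_child b))%:R :> R.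
  rewrite -natr_sum ler_nat; under eq_bigr do rewrite size_filter -sum1_count.
  rewrite -sum1_size (exchange_big_dep predT) //= big_seq [leqRHS]big_seq.
  apply: leq_sum => p /in_c/(child_cover h0)[b pb].
  by rewrite (bigD1 b).
move=> /le_trans; apply; apply: le_trans (ler_sum _ (fun b _ => child_le b)) _.
by rewrite -mulr_sumr exprSr /= -!mulrA mulVKf// lt0r_neq0.
Qed.

(* The Calderon-Zygmund stopping-time argument, as an induction on the
   dyadic tree. *)
Lemma calderon_zygmund P Q (delta : R) j c h : 0 <= delta < 1 -> 0 <= h ->
  (forall k a s b, (k < j)%N -> 0 <= s -> subcube a s c h ->
     s / 2 ^+ k.+1 = h / 2 ^+ j ->
     delta < dens P k (child a s b) (s / 2) -> dens Q k.+1 a s = 1) ->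
  dens P j c h <= delta -> dens P j c h <= delta * dens Q j c h.
Proof.
move=> /andP[d0 d1] h0; elim: j c h h0 => [|j IH] c h h0 dense_parent /= Pd.
  by case: (P c h) Pd => /= Pd; [lra|rewrite mulr_ge0].
have [[b Pb]|sparse] := pselect (exists b, delta < dens P j (child c h b) (h / 2)).
  have := dense_parent j c h b (ltnSn j) h0; rewrite /subcube subrr normr0 add0r.
  by move=> /(_ (lexx _) erefl Pb) /= ->; rewrite mulr1.
rewrite mulrCA ler_wpM2l ?invr_ge0 ?(ltW cells_gt0)// mulr_sumr; apply: ler_sum => b _.
apply: IH => [|k a s b' kj s0 as_ sE|]; first by rewrite divr_ge0.
  apply: dense_parent => //; [exact: ltnW|exact: subcube_child as_|].
  by rewrite sE exprS invfM mulrA.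
by rewrite leNgt; apply/negP => ?; apply: sparse; exists b.
Qed.

End DyadicDensity.

Section Supersolution.
Variables (R : realType) (n : nat) (lam Lam : R).

Record supersolution (D : set 'rV[R]_n) (v : 'rV[R]_n -> R)
    (Hv A : 'rV[R]_n -> 'M[R]_n) : Prop := {
  super_ge0 : forall x, D x -> 0 <= v x;
  super_continuous : forall x, D x -> {for x, continuous v};
  super_hessian : unif_hessian D v Hv;
  super_sym : forall x, D x -> (Hv x)^T = Hv x;
  super_elliptic : forall x, D x -> elliptic lam Lam (A x);
  super_le0 : forall x, D x -> mxdot (A x) (Hv x) <= 0 }.

Lemma continuous_affine (V : topologicalType) (f : 'rV[R]_n -> V) (a x : 'rV[R]_n)
    (s : R) :
  {for a + s *: x, continuous f} -> {for x, continuous (fun y : 'rV[R]_n => f (a + s *: y))}.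
Proof.
move=> cf; apply: (@continuous_comp _ _ _ (fun y : 'rV[R]_n => a + s *: y) f _ _ cf).
exact: (cvgD (cvg_cst a) (@scaler_continuous _ _ s x)).
Qed.

Lemma supersolution_affine D D' v Hv A (a : 'rV[R]_n) (s k : R) : 0 <= k ->
  (forall x, D' x -> D (a + s *: x)) -> supersolution D v Hv A ->
  supersolution D' (fun x => k * v (a + s *: x))
    (fun x => k *: (s ^+ 2 *: Hv (a + s *: x))) (fun x => A (a + s *: x)).
Proof.
move=> k0 D'D [v0 cv vH symH ellA sup].
split=> [x /D'D Dx|x /D'D Dx||x /D'D Dx|x /D'D Dx|x /D'D Dx].
- by rewrite mulr_ge0 ?v0.
- exact: cvgMl_tmp (continuous_affine (cv _ Dx)).
- exact/unif_hessianZ/(unif_hessian_affine D'D).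
- by rewrite linearZ /= [_^T]linearZ /= symH.
- exact: ellA.
- by rewrite !mxdotZr mulr_ge0_le0 ?mulr_ge0_le0 ?sqr_ge0 ?sup.
Qed.

End Supersolution.

Lemma size_close_ffuns (I : finType) (N C : nat) (s : seq {ffun I -> 'I_N}) :
  uniq s -> (forall f g, f \in s -> g \in s -> forall i, (g i <= f i + C)%N) ->
  (size s <= C.*2.+1 ^ #|I|)%N.
Proof.
case: s => // f0 s; have := mem_head f0 s; move: (f0 :: s) => {}s f0s uniq_s close.
pose shift (f : {ffun I -> 'I_N}) : {ffun I -> 'I_C.*2.+1} :=
  [ffun i => inord (f i + C - f0 i)%N].
have shift_inj : {in s &, injective shift}.
  move=> f g fs gs /ffunP fg; apply/ffunP => i; apply/ord_inj.
  have ff0 := close _ _ fs f0s i; have f0f := close _ _ f0s fs i.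
  have gf0 := close _ _ gs f0s i; have f0g := close _ _ f0s gs i.
  have := congr1 val (fg i); rewrite !ffunE /=.
  move: (f i : nat) (g i : nat) (f0 i : nat) ff0 f0f gf0 f0g => a b d ? ? ? ?.
  by rewrite !inordK; lia.
rewrite -(size_map shift) -[leqRHS](_ : #|{ffun I -> 'I_C.*2.+1}| = _); last first.
  by rewrite card_ffun card_ord.
by rewrite -[size _](card_uniqP _) ?max_card// map_inj_in_uniq.
Qed.

Section Contact.
Variables (R : realType) (n : nat) (lam Lam : R) (m : nat).

Let rho : R := 64 * n%:R.
Let B : set 'rV[R]_n := [set x | enorm2 x <= rho].

Definition contact_height : R := 2 ^+ m.+3.

Definition contact_opening : R := 1 + contact_height / rho *
  (2 * m.+2%:R + 2 * m.+2%:R * (n%:R * Lam / lam) + 4 * (m.+2 * m.+1)%:R).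

Definition slope_gap : nat := (Num.truncn (8 * n%:R * contact_opening)).+1.

Definition contact_density : R := ((32 * n ^ 2 * slope_gap.*2.+1) ^ n)%:R^-1.

Hypotheses (n_gt0 : (0 < n)%N) (lam_gt0 : 0 < lam) (Lam_gt0 : 0 < Lam).

Let n_ge1 : 1 <= n%:R :> R. Proof. by rewrite ler1n. Qed.
Let n_pos : 0 < n%:R :> R. Proof. by rewrite ltr0n. Qed.
Let rho_gt0 : 0 < rho. Proof. by rewrite mulr_gt0. Qed.
Let height_gt0 : 0 < contact_height. Proof. exact: exprn_gt0. Qed.

Lemma contact_opening_ge0 : 0 <= contact_opening.
Proof.
rewrite addr_ge0// mulr_ge0 ?divr_ge0 ?(ltW height_gt0) ?(ltW rho_gt0)//.
by rewrite !addr_ge0// !mulr_ge0 ?invr_ge0 ?ler0n ?(ltW lam_gt0) ?(ltW Lam_gt0).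
Qed.

Lemma contact_density_itv : 0 < contact_density <= 1.
Proof.
have cells_gt0 : (0 < (32 * n ^ 2 * slope_gap.*2.+1) ^ n)%N.
  by rewrite expn_gt0 !muln_gt0 n_gt0.
by rewrite invr_gt0 ltr0n cells_gt0 invf_le1 ?ltr0n// ler1n.
Qed.

Hypothesis m_large : 32 * n%:R ^+ 2 * Lam < m.+1%:R * lam.

Lemma mxdot_barrier_hess_ge (A : 'M[R]_n) x : elliptic lam Lam A -> B x ->
  - (2 * m.+2%:R * (n%:R * Lam) / rho) <= mxdot A (barrier_hess rho m x).
Proof.
move=> ellA Bx; have b0 := cap_ge0 rho_gt0 Bx; rewrite mxdot_barrier_hess.
apply: ler_wpDr.
  rewrite mulr_ge0 ?divr_ge0 ?sqr_ge0 ?mulr_ge0 ?exprn_ge0//.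
  by have /andP[+ _] := ellA x; apply: le_trans; rewrite mulr_ge0 ?enorm2_ge0 ?ltW.
rewrite mulNr lerN2 mulrAC ler_pM2r ?invr_gt0// -!mulrA !ler_pM2l//.
have /andP[b1 b2] := cap_exp_itv rho_gt0 m.+1 Bx.
apply: le_trans (ler_wpM2l b1 (trace_elliptic_le ellA)) _.
by rewrite ler_piMl// mulr_ge0 ?(ltW Lam_gt0).
Qed.

Lemma mxdot_barrier_hess_gt0 (A : 'M[R]_n) x : elliptic lam Lam A -> B x ->
  0 < cap rho x -> 1 <= enorm2 x -> 0 < mxdot A (barrier_hess rho m x).
Proof.
move=> ellA Bx cap_gt0 x1; rewrite mxdot_barrier_hess.
have -> : - (2 * m.+2%:R * cap rho x ^+ m.+1 / rho) * \tr A
    + 4 * (m.+2 * m.+1)%:R * cap rho x ^+ m / rho ^+ 2 * qform A x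
  = 2 * m.+2%:R * cap rho x ^+ m / rho
    * (2 * m.+1%:R * qform A x / rho - cap rho x * \tr A).
  by rewrite natrM exprS; field; exact: lt0r_neq0.
rewrite mulr_gt0 ?divr_gt0 ?mulr_gt0 ?exprn_gt0// subr_gt0.
apply: le_lt_trans (_ : n%:R * Lam < _).
  apply: le_trans (ler_wpM2l (ltW cap_gt0) (trace_elliptic_le ellA)) _.
  by rewrite ler_piMl ?cap_le1// mulr_ge0 ?(ltW Lam_gt0).
rewrite ltr_pdivlMr//; apply: lt_le_trans (_ : 2 * m.+1%:R * lam <= _).
  have -> : n%:R * Lam * rho = 2 * (32 * n%:R ^+ 2 * Lam) by rewrite /rho; ring.
  by rewrite -[ltRHS]mulrA ltr_pM2l.
rewrite ler_wpM2l ?mulr_ge0//; have /andP[+ _] := ellA x; apply: le_trans.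
by rewrite ler_peMr// ltW.
Qed.

Variables (v : 'rV[R]_n -> R) (Hv A : 'rV[R]_n -> 'M[R]_n).
Hypothesis super : supersolution lam Lam B v Hv A.
Implicit Types (x y z p : 'rV[R]_n).

Let w x : R := v x + - contact_height * barrier rho m x.
Let Hw x : 'M[R]_n := Hv x + - contact_height *: barrier_hess rho m x.

Let contact p x := B x /\ forall y, B y -> w x + dot p (y - x) <= w y.

Lemma contact_exists p : exists x, contact p x.
Proof.
have cw x : B x -> {for x, continuous (fun y => w y - dot p y)}.
  move=> Bx; have cb := @cap_exp_continuous R n rho m.+2 x.
  exact: cvgB (cvgD (super_continuous super Bx) (cvgMl_tmp cb)) (@dot_continuous R n p x).
have [|||x + xmin] := @compact_EVT_min _ _ (fun y => w y - dot p y) B.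
- by exists 0; rewrite /B /= enorm2_0 ltW.
- exact: compact_enorm2_le.
- by apply: continuous_in_subspaceT => x; rewrite inE => /cw.
rewrite inE => Bx; exists x; split=> // y By.
by have := xmin y; rewrite inE => /(_ By); rewrite dotDr dotNr; lra.
Qed.

Lemma contact_low p x x0 : contact p x -> `|p| <= (32 * n%:R ^+ 2)^-1 ->
  `|x0| <= 3 -> v x0 <= 1 -> w x <= - 2^-1.
Proof.
move=> [Bx ctc] p_le x0_le vx0.
have x0E : enorm2 x0 <= 9 * n%:R.
  apply: le_trans (enorm2_le_norm _) _; rewrite mulrC ler_pM2r//.
  have : `|x0| ^+ 2 <= 3 ^+ 2 by rewrite lerXn2r ?nnegrE.
  by lra.
have Bx0 : B x0 by rewrite /B /= /rho; move: n_pos x0E; lra.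
have dot_le y : B y -> `|dot p y| <= 4^-1.
  move=> By; rewrite -(@ler_pXn2r _ 2) ?nnegrE// real_normK ?num_real//.
  apply: le_trans (cauchy_schwarz _ _) _.
  have p2 : enorm2 p <= n%:R * (32 * n%:R ^+ 2)^-1 ^+ 2.
    by apply: le_trans (enorm2_le_norm _) _; rewrite ler_pM2l// lerXn2r ?nnegrE.
  apply: le_trans (ler_pM (enorm2_ge0 _) (enorm2_ge0 _) p2 By) _.
  have -> : n%:R * (32 * n%:R ^+ 2)^-1 ^+ 2 * rho = 4^-1 ^+ 2 / n%:R ^+ 2.
    by rewrite /rho; field; exact: lt0r_neq0.
  by rewrite ler_pdivrMr ?exprn_gt0// ler_peMr ?sqr_ge0// exprn_ege1.
have wx0 : w x0 <= - 1.
  have bx0 : 2^-1 <= cap rho x0.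
    by rewrite lerBrDl -lerBrDr ler_pdivrMr// /rho; move: n_pos x0E; lra.
  have : 2^-1 ^+ m.+2 <= barrier rho m x0 by rewrite lerXn2r ?nnegrE//; lra.
  have -> : 2^-1 ^+ m.+2 = 2 / contact_height :> R.
    by rewrite exprVn /contact_height (exprS _ m.+2); field; rewrite expf_neq0.
  by rewrite ler_pdivrMr// /w mulNr; move: vx0; lra.
have := ctc x0 Bx0; have := dot_le _ Bx; have := dot_le _ Bx0.
by rewrite !ler_norml !dotDr !dotNr; lra.
Qed.

Lemma contact_interior p x : contact p x -> w x <= - 2^-1 ->
  0 < cap rho x /\ v x <= contact_height.
Proof.
move=> [Bx _]; have /andP[b0 b1] := cap_exp_itv rho_gt0 m.+2 Bx.
have vx := super_ge0 super Bx; rewrite /w mulNr => wx; split.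
  rewrite lt0r (cap_ge0 rho_gt0 Bx) andbT; apply/eqP => bx0.
  by move: wx; rewrite /barrier bx0 expr0n mulr0; lra.
have : contact_height * barrier rho m x <= contact_height by rewrite ler_piMr// ltW.
by move: wx; lra.
Qed.

Lemma contact_hess_psd p x : contact p x -> 0 < cap rho x -> psd (Hw x).
Proof.
move=> [Bx ctc] cap_gt0; have hess_w : unif_hessian B w Hw.
  apply: unif_hessianD (super_hessian super) _; apply: unif_hessianZ.
  exact/barrier_unif_hessian/compact_enorm2_le.
apply: (unif_hessian_psd hess_w Bx).
  by rewrite /Hw raddfD /= [X in _ + X]linearZ /= barrier_hess_sym (super_sym super Bx).
have near_B : \forall z \near (0 : 'rV[R]_n), B (x + z).
  apply/(nbhs0P B x); have /cvgr_gt/(_ _ cap_gt0) := @cap_continuous R n rho x.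
  by apply: filterS => y /ltW; rewrite subr_ge0 ler_pdivrMr ?mul1r.
have near_BN : \forall z \near (0 : 'rV[R]_n), B (x - z).
  have := @opp_continuous 'rV[R]_n 0; rewrite /continuous_at oppr0.
  by move=> /(_ _ near_B).
apply: filterS2 near_B near_BN => z /ctc + /ctc.
rewrite !(addrAC x _ (- x)) subrr !add0r dotNr /second_diff mulr2n; lra.
Qed.

Lemma contact_trace_le p x : contact p x -> 0 < cap rho x ->
  \tr (Hw x) <= contact_height / rho * (2 * m.+2%:R * (n%:R * Lam / lam)).
Proof.
move=> ctc cap_gt0; have [Bx _] := ctc; have ellA := super_elliptic super Bx.
rewrite -(ler_pM2l lam_gt0); have psdHw := contact_hess_psd ctc cap_gt0.
apply: le_trans (elliptic_mxdot_psd ellA psdHw) _.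
rewrite mxdotDr mxdotZr; have := super_le0 super Bx.
have := ler_wpM2l (ltW height_gt0) (mxdot_barrier_hess_ge ellA Bx).
have -> : lam * (contact_height / rho * (2 * m.+2%:R * (n%:R * Lam / lam)))
  = - (contact_height * - (2 * m.+2%:R * (n%:R * Lam) / rho)).
  by field; rewrite !lt0r_neq0.
by rewrite mulNr; lra.
Qed.

Lemma contact_unit_ball p x : contact p x -> 0 < cap rho x -> enorm2 x < 1.
Proof.
move=> ctc cap_gt0; have [Bx _] := ctc; have ellA := super_elliptic super Bx.
have psdHw := contact_hess_psd ctc cap_gt0; rewrite ltNge; apply/negP => x1.
have := mulr_gt0 height_gt0 (mxdot_barrier_hess_gt0 ellA Bx cap_gt0 x1).
have := elliptic_mxdot_psd ellA psdHw; rewrite mxdotDr mxdotZr.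
have := mulr_ge0 (ltW lam_gt0) (psd_trace_ge0 psdHw).
by have := super_le0 super Bx; lra.
Qed.

Lemma unit_ball_add x z : enorm2 x <= 1 -> enorm2 z <= 16 * n%:R -> B (x + z).
Proof.
move=> x1 zn; rewrite /B /= /rho; apply: le_trans (enorm2D_le _ _) _.
by have := n_ge1; lra.
Qed.

Lemma contact_paraboloid p x z : contact p x -> 0 < cap rho x ->
  enorm2 x <= 1 -> enorm2 z <= 16 * n%:R ->
  second_diff v x z <= qform (Hv x) z + enorm2 z ->
  w (x + z) <= w x + dot p z + contact_opening * enorm2 z.
Proof.
move=> ctc cap_gt0 x1 zn vz; have [Bx ctc_ge] := ctc.
have Bp : B (x + z) by exact: unit_ball_add.
have Bm : B (x - z) by apply: unit_ball_add; rewrite ?enorm2N.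
have z0 := enorm2_ge0 z.
have trHw := ler_wpM2r z0 (contact_trace_le ctc cap_gt0).
have := psd_qform_le z (contact_hess_psd ctc cap_gt0); rewrite qformD qformZ => qHw.
have := second_diff_barrier_ge m rho_gt0 Bp Bm.
move=> /(ler_wpM2l (ltW height_gt0)) sd_b.
have := qform_barrier_hess_le m rho_gt0 z Bx.
move=> /(ler_wpM2l (ltW height_gt0)) qD.
have sdE : second_diff w x z
    = second_diff v x z - contact_height * second_diff (barrier rho m) x z.
  by rewrite /second_diff /w; ring.
have sd_w : second_diff w x z <= contact_opening * enorm2 z.
  have -> : contact_opening * enorm2 z = enorm2 z
      - contact_height * (- (2 * m.+2%:R / rho) * enorm2 z)
      + contact_height / rho * (2 * m.+2%:R * (n%:R * Lam / lam)) * enorm2 z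
      + contact_height * (4 * (m.+2 * m.+1)%:R / rho * enorm2 z).
    by rewrite /contact_opening; ring.
  by move: qHw trHw sd_b qD vz; rewrite sdE; lra.
have := ctc_ge _ Bm; rewrite (addrAC x (- z)) subrr add0r dotNr.
by move: sd_w; rewrite /second_diff; lra.
Qed.

Lemma contact_point p x0 : `|p| <= (32 * n%:R ^+ 2)^-1 -> `|x0| <= 3 -> v x0 <= 1 ->
  exists x, [/\ contact p x, enorm2 x < 1, v x <= contact_height &
    forall z, enorm2 z <= 16 * n%:R ->
      second_diff v x z <= qform (Hv x) z + enorm2 z ->
      w (x + z) <= w x + dot p z + contact_opening * enorm2 z].
Proof.
move=> p_le x0_le vx0; have [x ctc] := contact_exists p.
have [cap_gt0 vx] := contact_interior ctc (contact_low ctc p_le x0_le vx0).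
have x1 := contact_unit_ball ctc cap_gt0.
by exists x; split=> // z; apply: contact_paraboloid (ltW x1).
Qed.

(* At [x] the function [w] is squeezed between a plane of slope [p] and a
   paraboloid, which leaves a plane of slope [p'] touching [w] nearby no room to tilt. *)
Lemma contact_slopes_close p p' x x' (eta : R) i : 0 < eta <= 1 ->
  contact p x -> contact p' x' -> enorm2 x' < 1 ->
  (forall z, `|z| <= 4 * eta ->
     w (x + z) <= w x + dot p z + contact_opening * enorm2 z) ->
  `|x - x'| <= 2 * eta ->
  p' ord0 i - p ord0 i <= 8 * n%:R * contact_opening * eta.
Proof.
move=> /andP[eta0 eta1] [_ ctc] [Bx' ctc'] x'1 above xx'.
pose d : 'rV[R]_n := (2 * eta) *: delta_mx ord0 i.
have eta2 : 0 < 2 * eta by rewrite mulr_gt0.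
have d_le : `|d| <= 2 * eta.
  by rewrite normrZ gtr0_norm// ler_piMr ?(ltW eta2)// norm_unit_le1 ?enorm2_delta.
have Bd : B (x' + d).
  apply: unit_ball_add; first exact: ltW.
  rewrite enorm2Z enorm2_delta mulr1 exprMn.
  have eta_sq : eta ^+ 2 <= 1 by rewrite exprn_ile1// ltW.
  by have := n_ge1; lra.
have zE : x + (x' + d - x) = x' + d by rewrite addrC subrK.
have z_le : `|x' + d - x| <= 4 * eta.
  rewrite (_ : x' + d - x = d - (x - x')); last by rewrite opprB addrA (addrC d).
  by apply: le_trans (ler_normB _ _) _; lra.
have z2_le : enorm2 (x' + d - x) <= 16 * n%:R * eta ^+ 2.
  apply: le_trans (enorm2_le_norm _) _.
  have : `|x' + d - x| ^+ 2 <= (4 * eta) ^+ 2 by rewrite lerXn2r ?nnegrE// mulr_ge0// ltW.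
  by move=> /(ler_wpM2l (ltW n_pos)); lra.
have up := above _ z_le; have low' := ctc' _ Bd; have low := ctc _ Bx'.
rewrite zE in up; rewrite [x' + d - x']addrAC subrr add0r in low'.
have up_le := ler_wpM2l contact_opening_ge0 z2_le.
rewrite -(ler_pM2l eta2); have -> : 2 * eta * (p' ord0 i - p ord0 i) = dot p' d - dot p d.
  by rewrite /d !dotZr !dot_delta; ring.
by move: up low low' up_le; rewrite !dotDr !dotNr; lra.
Qed.

Variable j : nat.
Let eta : R := 1 / 2 ^+ j.
Let grid : nat := (2 ^ j %/ (32 * n ^ 2))%N.
Let slope (f : {ffun 'I_n -> 'I_grid.+1}) : 'rV[R]_n := \row_i (eta * (f i)%:R).

Hypothesis v_above : hessian_above B v Hv 1 (4 * eta).

Let eta_itv : 0 < eta <= 1.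
Proof. by rewrite divr_gt0 ?exprn_gt0//= ler_pdivrMr ?exprn_gt0// mul1r exprn_ege1// ler1n. Qed.

Let eta_gt0 : 0 < eta. Proof. by have /andP[] := eta_itv. Qed.

Lemma slope_le f : `|slope f| <= (32 * n%:R ^+ 2)^-1.
Proof.
have n2_gt0 : 0 < 32 * n%:R ^+ 2 :> R by rewrite mulr_gt0 ?exprn_gt0.
apply: mx_norm_le => [|o i]; first by rewrite invr_ge0 ltW.
rewrite mxE ger0_norm ?mulr_ge0 ?(ltW eta_gt0)// /eta mul1r ler_pdivrMl ?exprn_gt0//.
rewrite ler_pdivlMr// -!natrX -!natrM ler_nat.
by apply: leq_trans (leq_divM (2 ^ j) (32 * n ^ 2)); rewrite leq_mul2r -ltnS ltn_ord orbT.
Qed.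

Let contact_at f x := [/\ contact (slope f) x, enorm2 x < 1 &
  forall z, enorm2 z <= 16 * n%:R ->
    second_diff v x z <= qform (Hv x) z + enorm2 z ->
    w (x + z) <= w x + dot (slope f) z + contact_opening * enorm2 z].

Lemma contact_grid_close f g x y a i : contact_at f x -> contact_at g y ->
  `|x - a| <= eta -> `|y - a| <= eta -> (g i <= f i + slope_gap)%N.
Proof.
move=> [ctc x1 above] [ctc' y1 _] xa ya; have /andP[eta0 eta1] := eta_itv.
have xy : `|x - y| <= 2 * eta.
  rewrite (_ : x - y = (x - a) - (y - a)); last by rewrite opprB addrA subrK.
  by apply: le_trans (ler_normB _ _) _; lra.
have above_near z : `|z| <= 4 * eta ->
    w (x + z) <= w x + dot (slope f) z + contact_opening * enorm2 z.
  move=> z_le; apply: above; last first.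
    by have [Bx _] := ctc; have := v_above Bx z_le; rewrite mul1r.
  apply: le_trans (enorm2_le_norm _) _; rewrite mulrC ler_pM2r//.
  have : `|z| ^+ 2 <= 4 ^+ 2 by rewrite lerXn2r ?nnegrE//; lra.
  by lra.
have := contact_slopes_close i eta_itv ctc ctc' y1 above_near xy.
rewrite !mxE -mulrBr mulrC ler_pM2r// lerBlDl => gf.
have := le_trans gf (lerD (lexx _) (ltW (truncnS_gt (8 * n%:R * contact_opening)))).
by rewrite -natrD ler_nat.
Qed.

Lemma contact_density_le x0 : `|x0| <= 3 -> v x0 <= 1 -> contact_density <=
  dens (fun a s => `[< exists2 x, cube a s x & v x <= contact_height >]) j 0 1.
Proof.
move=> x0_le vx0; pose meets (a : 'rV[R]_n) (s : R) :=
  `[< exists2 x, cube a s x & v x <= contact_height >].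
have /choice[X X_point] f := contact_point (slope_le f) x0_le vx0.
have X_contact f : contact_at f (X f) by have [] := X_point f.
pose slopes := enum {ffun 'I_n -> 'I_grid.+1}.
have per_cell a : (count (fun x => `|x - a| <= eta)%R [seq X f | f <- slopes]
    <= slope_gap.*2.+1 ^ n)%N.
  rewrite count_map -size_filter -[X in (_ <= _ ^ X)%N]card_ord.
  apply: size_close_ffuns => [|f g]; first by rewrite filter_uniq ?enum_uniq.
  rewrite !mem_filter => /andP[/= fa _] /andP[/= ga _] i.
  exact: contact_grid_close (X_contact f) (X_contact g) fa ga.
have grid_le : (grid.+1 ^ n)%:R
    <= (slope_gap.*2.+1 ^ n)%:R * (2 ^+ n) ^+ j * dens meets j 0 1.
  have <- : size [seq X f | f <- slopes] = (grid.+1 ^ n)%N.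
    by rewrite size_map -cardE card_ffun !card_ord.
  apply: size_le_dens => // _ /mapP[f _ ->].
    rewrite /cube /= subr0 -(@ler_pXn2r _ 2) ?nnegrE// expr1n.
    by have [_ /ltW + _ _] := X_point f; apply: le_trans; exact: norm_sqr_le_enorm2.
  by move=> a Xa; apply/asboolP; exists (X f) => //; have [] := X_point f.
have cells_le : ((2 ^ j) ^ n <= grid.+1 ^ n * (32 * n ^ 2) ^ n)%N.
  by rewrite -expnMn leq_exp2r// ltnW// ltn_ceil// !muln_gt0 n_gt0.
rewrite /contact_density -div1r ler_pdivrMr; last first.
  by rewrite ltr0n expn_gt0 !muln_gt0 n_gt0.
have cells_gt0 : 0 < ((2 ^ j) ^ n)%:R :> R by rewrite ltr0n !expn_gt0.
rewrite -(ler_pM2l cells_gt0) mulr1.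
move: cells_le; rewrite -(ler_nat R) natrM => /le_trans; apply.
apply: le_trans (ler_wpM2r _ grid_le) _ => //.
rewrite le_eqVlt; apply/orP; left; apply/eqP.
rewrite !expnMn !natrM -[(2 ^+ n) ^+ j]exprM -expnM (mulnC j) !natrX; ring.
Qed.

End Contact.

Section WeakHarnack.
Variables (R : realType) (n : nat) (lam Lam : R).
Hypotheses (n_gt0 : (0 < n)%N) (lam_gt0 : 0 < lam) (Lam_gt0 : 0 < Lam).

Definition exceeds (v : 'rV[R]_n -> R) (T : R) (a : 'rV[R]_n) (s : R) : bool :=
  `[< forall x, cube a s x -> T < v x >].

Section DyadicScale.
Variables (m : nat) (c : 'rV[R]_n) (h t : R) (J : nat).
Variables (v : 'rV[R]_n -> R) (Hv A : 'rV[R]_n -> 'M[R]_n).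
Hypothesis m_large : 32 * n%:R ^+ 2 * Lam < m.+1%:R * lam.
Hypotheses (h_gt0 : 0 < h) (t_gt0 : 0 < t).

Let D : set 'rV[R]_n := cube c (9 * n%:R * h).
Let M : R := contact_height R m.
Let mu : R := contact_density n lam Lam m.

Hypothesis super : supersolution lam Lam D v Hv A.
Hypothesis v_above : hessian_above D v Hv (t / h ^+ 2) (4 * (h / 2 ^+ J)).

Lemma subcube_ball a s y : 0 < s -> subcube a s c h ->
  enorm2 y <= 64 * n%:R -> D (a + s *: y).
Proof.
move=> s0 ac y_le; have n1 : 1 <= n%:R :> R by rewrite ler1n.
have y8 : `|y| <= 8 * n%:R.
  rewrite -(@ler_pXn2r _ 2) ?nnegrE ?mulr_ge0//.
  apply: le_trans (le_trans (norm_sqr_le_enorm2 _) y_le) _.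
  have -> : (8 * n%:R) ^+ 2 = 64 * n%:R * n%:R :> R by ring.
  by rewrite ler_peMr ?mulr_ge0.
have sy : `|s *: y| <= 8 * (n%:R * s).
  by rewrite normrZ gtr0_norm// mulrC mulrA ler_pM2r.
rewrite /D /cube /= addrAC; apply: le_trans (ler_normD _ _) _.
have ac_n : n%:R * (`|a - c| + s) <= n%:R * h by rewrite ler_wpM2l.
have := ler_wpM2r (normr_ge0 (a - c)) n1; have := ler_wpM2r (ltW s0) n1.
by have := normr_ge0 (a - c); move: s0 ac_n sy; lra.
Qed.

Lemma dens_exceeds_le T j a x s : t <= T -> 0 < s -> subcube a s c h ->
  s / 2 ^+ j = h / 2 ^+ J -> `|x - a| <= 3 * s -> v x <= T ->
  dens (exceeds v (M * T)) j a s <= 1 - mu.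
Proof.
move=> tT s0 ac sE xa vx; have T0 : 0 < T := lt_le_trans t_gt0 tT.
have in_D y : enorm2 y <= 64 * n%:R -> D (a + s *: y) by exact: subcube_ball.
have TV0 : 0 <= T^-1 by rewrite invr_ge0 ltW.
have super' := supersolution_affine TV0 in_D super.
pose y0 := s^-1 *: (x - a).
have y0E : a + s *: y0 = x by rewrite scalerA mulfV ?scale1r ?lt0r_neq0// addrC subrK.
have y0_le : `|y0| <= 3 by rewrite normrZ gtr0_norm ?invr_gt0// ler_pdivrMl// mulrC.
have above' : hessian_above [set y | enorm2 y <= 64 * n%:R] (fun y => T^-1 * v (a + s *: y))
    (fun y => T^-1 *: (s ^+ 2 *: Hv (a + s *: y))) 1 (4 * (1 / 2 ^+ j)).
  have -> : 4 * (1 / 2 ^+ j) = 4 * (h / 2 ^+ J) / s.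
    by rewrite -sE; field; rewrite lt0r_neq0 ?expf_neq0.
  apply: hessian_above_le (hessian_above_affine TV0 s0 in_D v_above).
  have sh : s <= h by apply: le_trans ac; rewrite lerDr.
  rewrite -mulrA ler_pdivrMl// mulr1 mulrCA; apply: le_trans tT.
  rewrite ler_piMr ?(ltW t_gt0)// ler_pdivrMr ?exprn_gt0// mul1r.
  by rewrite lerXn2r ?nnegrE ?(ltW s0) ?(ltW h_gt0).
have := contact_density_le n_gt0 lam_gt0 Lam_gt0 m_large super' above' y0_le.
rewrite y0E ler_pdivrMl// mulr1 => /(_ vx); rewrite -/mu => mu_le.
have exceedsC := densC (exceeds v (M * T)) j a s.
suff : mu <= dens (fun b r => ~~ exceeds v (M * T) b r) j a s by rewrite exceedsC; lra.
have <- : dens (fun b r => ~~ exceeds v (M * T) (a + s *: b) (s * r)) j 0 1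
    = dens (fun b r => ~~ exceeds v (M * T) b r) j a s.
  by rewrite (dens_affine (fun b r => ~~ exceeds v (M * T) b r)) scaler0 addr0 mulr1.
apply: le_trans mu_le _; apply: dens_le => // b _ /asboolP[y yb vy].
have {}vy : v (a + s *: y) <= M * T by rewrite -ler_pdivrMr// mulrC.
apply/asboolPn => /(_ (a + s *: y)); rewrite ltNge vy; apply/not_implyP; split=> //.
rewrite /cube /= opprD addrACA subrr add0r -scalerBr normrZ gtr0_norm//.
by rewrite ler_pM2l.
Qed.

Lemma weak_harnack_iter k x : cube c h x -> v x <= t ->
  dens (exceeds v (M ^+ k * t)) J c h <= (1 - mu) ^+ k.
Proof.
move=> xh vx; have /andP[mu0 mu1] : 0 < mu <= 1 by exact: contact_density_itv.
have M1 l : t <= M ^+ l * t.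
  by rewrite ler_peMl ?(ltW t_gt0)// exprn_ege1// exprn_ege1// ler1n.
elim: k => [|k IH].
  rewrite expr0; have := dens_ge0 (fun a s => ~~ exceeds v (M ^+ 0 * t) a s) J c h.
  by rewrite densC subr_ge0.
have exceedsS : exceeds v (M ^+ k.+1 * t) = exceeds v (M * (M ^+ k * t)).
  by rewrite exprS mulrA.
have top : dens (exceeds v (M ^+ k.+1 * t)) J c h <= 1 - mu.
  rewrite exceedsS; apply: (@dens_exceeds_le _ J c x) => //.
  - by rewrite /subcube subrr normr0 add0r.
  - by move: xh h_gt0; rewrite /cube /=; lra.
  - exact: le_trans vx (M1 k).
rewrite [leRHS]exprS; apply: le_trans (ler_wpM2l _ IH); last by lra.
apply: calderon_zygmund top => //; [by apply/andP; split; lra|exact: ltW|].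
move=> j a s b jJ s_ge0 as_c sE dense.
have s0 : 0 < s.
  by rewrite -(pmulr_lgt0 _ (_ : 0 < (2 ^+ j.+1)^-1)) ?invr_gt0 ?exprn_gt0// sE divr_gt0 ?exprn_gt0.
have all_above y : cube a s y -> M ^+ k * t < v y.
  move=> ya; rewrite ltNge; apply/negP => vy; move: dense; apply/negP.
  rewrite -leNgt exceedsS; have ca := child_dist a b s_ge0.
  have := ler_normD (child a s b - a) (a - c); rewrite subrKA => cc.
  have := ler_normB (y - a) (child a s b - a); rewrite opprB addrA subrK => yc.
  apply: (@dens_exceeds_le _ j (child a s b) y (s / 2)) => //.
  - by rewrite divr_gt0.
  - by move: as_c; rewrite /subcube; lra.
  - by rewrite -sE exprS invfM mulrA.
  - by move: ya; rewrite /cube /=; lra.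
apply: dens_eq1 => // a' /subcube_sub sub; apply/asboolP => y /sub.
exact: all_above.
Qed.

End DyadicScale.

Lemma near_dyadic_lt (h d : R) : 0 < d -> \forall J \near \oo, h / 2 ^+ J < d.
Proof.
move=> d0; have half_lt1 : `|2^-1 : R| < 1 by rewrite gtr0_norm ?invf_lt1 ?ltr1n.
have /cvgr_lt/(_ _ d0) := @cvg_geometric R h _ half_lt1.
by apply: filterS => J; rewrite /geometric /= exprVn.
Qed.

Lemma weak_harnack (eps : R) : 0 < eps -> exists2 M : R, 0 < M &
  forall c h t v Hv A x, 0 < h -> 0 < t ->
  supersolution lam Lam (cube c (9 * n%:R * h)) v Hv A ->
  cube c h x -> v x <= t ->
  \forall J \near \oo, dens (exceeds v (M * t)) J c h <= eps.
Proof.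
move=> eps0; pose m := Num.truncn (32 * n%:R ^+ 2 * Lam / lam).
have m_large : 32 * n%:R ^+ 2 * Lam < m.+1%:R * lam.
  by rewrite -ltr_pdivrMr// truncnS_gt.
pose mu := contact_density n lam Lam m.
have /andP[mu0 mu1] : 0 < mu <= 1 by exact: contact_density_itv.
have mu_lt1 : `|1 - mu| < 1 by rewrite ltr_norml; lra.
have /cvgr_lt/(_ _ eps0)/filter_ex[k /ltW k_eps] := cvg_expr mu_lt1.
exists (contact_height R m ^+ k) => [|c h t v Hv A x h0 t0 super xh vx].
  by rewrite !exprn_gt0.
have e0 : 0 < t / h ^+ 2 by rewrite divr_gt0 ?exprn_gt0.
have [d d0 above] := unif_hessian_above (super_hessian super) e0.
have d4 : 0 < d / 4 by rewrite divr_gt0.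
apply: filterS (near_dyadic_lt h d4) => J hJ; apply: le_trans k_eps.
apply: (weak_harnack_iter m_large h0 t0 super _ k xh vx) => y z Dy z_le.
by apply: above => //; apply: le_trans z_le _; lra.
Qed.

End WeakHarnack.

Section EvansKrylov.
Variables (R : realType) (n : nat) (lam Lam : R).
Hypotheses (lam_gt0 : 0 < lam) (Lam_gt0 : 0 < Lam).
Implicit Types (a c e x y z : 'rV[R]_n) (D : set 'rV[R]_n).
Implicit Types (u : 'rV[R]_n -> R) (H A : 'rV[R]_n -> 'M[R]_n).

(* [H] is the Hessian of [u] and [A x] is the inner normal at [H x] to the
   convex set [F >= 0], so that every value [H y] lies on its positive side. *)
Record normal_hessian D u H A : Prop := {
  nh_continuous : forall x, D x -> {for x, continuous u};
  nh_hess_continuous : forall x, D x -> {for x, continuous H};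
  nh_hessian : unif_hessian D u H;
  nh_sym : forall x, D x -> (H x)^T = H x;
  nh_elliptic : forall x, D x -> elliptic lam Lam (A x);
  nh_normal : forall x y, D x -> D y -> 0 <= mxdot (A x) (H y - H x) }.

Lemma normal_hessian_sub D D' u H A : D' `<=` D ->
  normal_hessian D u H A -> normal_hessian D' u H A.
Proof.
move=> D'D [cu cH uH symH ellA posH].
split=> [x /D'D|x /D'D||x /D'D|x /D'D|x y /D'D Dx /D'D]; [exact: cu|exact: cH| |
  exact: symH|exact: ellA|exact: posH].
exact: unif_hessian_sub uH.
Qed.

Lemma normal_hessian_affine D D' u H A a (s k : R) : 0 <= k ->
  (forall x, D' x -> D (a + s *: x)) -> normal_hessian D u H A ->
  normal_hessian D' (fun x => k * u (a + s *: x))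
    (fun x => k *: (s ^+ 2 *: H (a + s *: x))) (fun x => A (a + s *: x)).
Proof.
move=> k0 D'D [cu cH uH symH ellA posH].
split=> [x /D'D Dx|x /D'D Dx||x /D'D Dx|x /D'D Dx|x y /D'D Dx /D'D Dy].
- exact: cvgMl_tmp (continuous_affine (cu _ Dx)).
- exact: cvgZl_tmp (cvgZl_tmp (continuous_affine (cH _ Dx))).
- exact/unif_hessianZ/(unif_hessian_affine D'D).
- by rewrite linearZ /= [_^T]linearZ /= symH.
- exact: ellA.
- by rewrite -!scalerBr !mxdotZr mulr_ge0 ?(mulr_ge0 (sqr_ge0 s)) ?posH.
Qed.

Lemma continuous_second_diff (V : normedModType R) (f : 'rV[R]_n -> V) x z :
  {for x + z, continuous f} -> {for x - z, continuous f} -> {for x, continuous f} ->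
  {for x, continuous (fun y => second_diff f y z)}.
Proof.
move=> fp fm fx; have shift a : {for x + a, continuous f} ->
    {for x, continuous (fun y => f (y + a))}.
  apply: (@continuous_comp _ _ _ (fun y : 'rV[R]_n => y + a) f).
  exact: cvgD cvg_id (cvg_cst a).
exact: cvgB (cvgD (shift _ fp) (shift _ fm)) (cvgMn fx).
Qed.

Lemma cube_shift x z : cube 0 2^-1 x -> `|z| <= 2^-1 -> cube 0 1 (x + z).
Proof.
by rewrite /cube /= !subr0 => x2 z2; apply: le_trans (ler_normD _ _) _; lra.
Qed.

Lemma second_quotient_supersolution u H A e (K tau : R) :
  normal_hessian (cube 0 1) u H A -> enorm2 e = 1 ->
  (forall x, cube 0 1 x -> qform (H x) e <= K) -> 0 < tau ->
  exists v Hv, supersolution lam Lam (cube 0 2^-1) v Hv A /\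
    forall x, cube 0 2^-1 x -> `|v x - (K - qform (H x) e)| <= tau.
Proof.
move=> [cu cH uH symH ellA posH] e1 K_max tau0.
have tau2 : 0 < tau / 2 by rewrite divr_gt0.
have half_gt0 : 0 < 2^-1 :> R by rewrite invr_gt0.
have [h [/andP[h0 h2] close]] : exists h, 0 < h <= 2^-1 /\ forall x, cube 0 1 x ->
    `|second_diff u x (h *: e) / h ^+ 2 - qform (H x) e| <= tau / 2.
  have near_close := second_quotient_close e uH tau2.
  have near_half := nbhs_right_le half_gt0.
  have [h [hclose [h2 h0]]] :=
    filter_ex (filterI near_close (filterI near_half (nbhs_right_gt 0))).
  by exists h; rewrite h0 h2.
have hh0 : 0 < h ^+ 2 by rewrite exprn_gt0.
have he_le : `|h *: e| <= h.
  by rewrite normrZ gtr0_norm// ler_piMr ?norm_unit_le1// ltW.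
have inD x : cube 0 2^-1 x -> [/\ cube 0 1 (x + h *: e), cube 0 1 (x - h *: e) & cube 0 1 x].
  move=> x2; split; first by apply: cube_shift => //; exact: le_trans h2.
    by apply: cube_shift => //; rewrite normrN; exact: le_trans h2.
  by rewrite -[x]addr0; apply: cube_shift => //; rewrite normr0.
pose quotient x := - (h ^+ 2)^-1 * second_diff u x (h *: e).
have quotient_close x : cube 0 1 x -> `|quotient x + qform (H x) e| <= tau / 2.
  by move=> /close; rewrite distrC /quotient mulNr mulrC addrC.
exists (fun x => K + tau / 2 + quotient x).
exists (fun x => - (h ^+ 2)^-1 *: second_diff H x (h *: e)); split; last first.
  by move=> x /inD[_ _ /quotient_close]; rewrite !ler_norml; lra.
split=> [x x2|x /inD[Dp Dm Dx]||x /inD[Dp Dm Dx]|x /inD[_ _]|x /inD[Dp Dm Dx]].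
- have [_ _ Dx] := inD x x2; have := K_max x Dx; have := quotient_close x Dx.
  by rewrite ler_norml; lra.
- have sd_u := continuous_second_diff (cu _ Dp) (cu _ Dm) (cu _ Dx).
  exact: cvgD (cvg_cst _) (cvgMl_tmp sd_u).
- by apply/unif_hessian_addc/unif_hessianZ/(unif_hessian_second_diff inD).
- rewrite linearZ /= /second_diff raddfB /= [(_ + _)^T]raddfD [(_ *+ _)^T]raddfMn /=.
  by rewrite !symH.
- exact: ellA.
- have -> : second_diff H x (h *: e) = (H (x + h *: e) - H x) + (H (x - h *: e) - H x).
    by rewrite /second_diff mulr2n opprD addrACA.
  rewrite mxdotZr mxdotDr mulNr oppr_le0 mulr_ge0 ?invr_ge0 ?(ltW hh0)//.
  by rewrite addr_ge0 ?posH.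
Qed.

Lemma pure_second_derivative_harnack (eps : R) : (0 < n)%N -> 0 < eps ->
  exists2 M : R, 0 < M & forall u H A e (K t : R) x0,
  normal_hessian (cube 0 1) u H A -> enorm2 e = 1 ->
  (forall x, cube 0 1 x -> qform (H x) e <= K) -> 0 < t ->
  cube 0 (18 * n%:R)^-1 x0 -> K - t <= qform (H x0) e ->
  \forall J \near \oo,
    dens (exceeds (fun x => K - qform (H x) e) (M * t)) J 0 (18 * n%:R)^-1 <= eps.
Proof.
move=> n_gt0 eps0; have [M M0 harnack] := weak_harnack n_gt0 lam_gt0 Lam_gt0 eps0.
have n1 : 1 <= n%:R :> R by rewrite ler1n.
exists (2 * M + 1) => [|u H A e K t x0 uH e1 K_max t0 x0h Kt]; first by lra.
set h := (18 * n%:R)^-1; have h0 : 0 < h by rewrite invr_gt0; lra.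
have hE : 9 * n%:R * h = 2^-1 by rewrite /h; field; lra.
have h2 : h <= 2^-1 by rewrite -hE ler_peMl ?(ltW h0)//; lra.
have [v [Hv [super v_close]]] := second_quotient_supersolution uH e1 K_max t0.
rewrite -hE in super; have t2 : 0 < 2 * t by rewrite mulr_gt0.
have vx0 : v x0 <= 2 * t.
  have := v_close x0 (le_trans x0h h2); rewrite ler_norml; lra.
apply: filterS (harnack _ _ _ _ _ _ _ h0 t2 super x0h vx0) => J.
apply: le_trans; apply: dens_le => [|a ah /asboolP low]; first exact: ltW.
apply/asboolP => x xa; have := low x xa.
have := v_close x (le_trans (subcube_sub ah xa) h2); rewrite ler_norml; lra.
Qed.

End EvansKrylov.

Section PopularValues.
Variable R : realType.

Lemma unit_ball_coloring p q (eps : R) : 0 < eps ->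
  exists (T : finType) (col : 'M[R]_(p, q) -> T), forall M N : 'M[R]_(p, q),
    `|M| <= 1 -> `|N| <= 1 -> col M = col N -> `|M - N| <= eps.
Proof.
move=> eps0; pose L := (Num.truncn eps^-1).+1.
pose level (M : 'M[R]_(p, q)) i j := (M i j + 1) * L%:R.
have level_itv M i j : `|M| <= 1 -> 0 <= level M i j < L.*2.+1%:R.
  move=> /(le_trans (mx_coord_le_norm M i j)); rewrite ler_norml => /andP[Mge Mle].
  rewrite mulr_ge0//=; last by lra.
  apply: le_lt_trans (_ : 2 * L%:R < _); first by rewrite ler_pM2r//; lra.
  by rewrite -natrM ltr_nat mul2n.
exists {ffun 'I_p * 'I_q -> 'I_L.*2.+1}.
exists (fun M => [ffun ij => inord (Num.truncn (level M ij.1 ij.2))]) => M N M1 N1 /ffunP MN.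
apply: mx_norm_le => [|i j]; first exact: ltW.
have /andP[M0 Mlt] := level_itv M i j M1; have /andP[N0 Nlt] := level_itv N i j N1.
have := congr1 val (MN (i, j)); rewrite !ffunE /= !inordK ?truncn_lt_nat// => levelE.
have /andP[Mge Mlt'] := truncn_itv M0; have /andP[Nge Nlt'] := truncn_itv N0.
rewrite levelE -natr1 in Mge Mlt'; rewrite -natr1 in Nlt'.
apply: le_trans (_ : L%:R^-1 <= _); last first.
  by rewrite invf_ple ?posrE// ltW// truncnS_gt.
rewrite -[leRHS]mul1r ler_pdivlMr// -[L%:R in leLHS]gtr0_norm// -normrM.
have -> : (M - N) i j * L%:R = level M i j - level N i j by rewrite !mxE /level; ring.
by rewrite ler_norml; lra.
Qed.

Lemma finite_coloring p q (eps : R) : 0 < eps ->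
  exists2 T : finType, (0 < #|T|)%N &
  forall (X : Type) (D : set X) (f : X -> 'M[R]_(p, q)) (M0 : 'M[R]_(p, q)) (w : R),
  0 < w -> (forall x, D x -> `|f x - M0| <= w) ->
  exists col : X -> T, forall x y, D x -> D y -> col x = col y ->
    `|f x - f y| <= eps * w.
Proof.
move=> eps0; have [T [col col_close]] := unit_ball_coloring p q eps0.
exists T => [|X D f M0 w w0 f_le]; first by apply/card_gt0P; exists (col 0).
have unit_ball x : D x -> `|w^-1 *: (f x - M0)| <= 1.
  by move=> /f_le; rewrite normrZ gtr0_norm ?invr_gt0// ler_pdivrMl// mulr1.
exists (fun x => col (w^-1 *: (f x - M0))) => x y /unit_ball Dx /unit_ball Dy.
move=> /(col_close _ _ Dx Dy); rewrite -scalerBr opprB subrKA normrZ.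
by rewrite gtr0_norm ?invr_gt0// ler_pdivrMl// mulrC.
Qed.

Variable n : nat.

(* By pigeonhole, one colour is popular at infinitely many dyadic scales. *)
Lemma popular_value (delta : R) : 0 < delta -> exists2 nu : R, 0 < nu &
  forall (H : 'rV[R]_n -> 'M[R]_n) c h, 0 < h ->
  (forall x, cube c h x -> {for x, continuous H}) ->
  (forall x, cube c h x -> `|H x - H c| <= 1) ->
  exists2 x1, cube c h x1 &
    ~ \forall J \near \oo, dens (fun a s =>
        `[< forall x, cube a s x -> `|H x - H x1| <= delta >]) J c h < nu.
Proof.
move=> delta0; have delta2 : 0 < delta / 2 by rewrite divr_gt0.
have [T T_neq0 coloring] := finite_coloring n n delta2.
have T_gt0 : 0 < #|T|%:R :> R by rewrite ltr0n.
exists #|T|%:R^-1 => [|H c h h0 cH osc]; first by rewrite invr_gt0.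
have [color color_close] := coloring _ _ H (H c) 1 ltr01 osc.
have [k k_popular] : exists k, ~ \forall J \near \oo,
    dens (fun a _ => color a == k) J c h < #|T|%:R^-1.
  apply: contrapT => unpopular.
  have : \forall J \near \oo, forall k, dens (fun a _ => color a == k) J c h < #|T|%:R^-1.
    by apply: filter_forall => k; apply: contrapT => k_pop; apply: unpopular; exists k.
  by move=> /filter_ex[J]; have [k] := popular_color color J c h; rewrite leNgt => /negP.
have [x1 x1h x1k] : exists2 x1, cube c h x1 & color x1 = k.
  apply: contrapT => no_x1; apply: k_popular; apply: nearW => J.
  rewrite ltNge; apply/negP => dens_ge.
  have dens_gt0 := lt_le_trans (_ : 0 < #|T|%:R^-1) dens_ge.
  have [|a ac /eqP ak] := dens_gt0_ex (ltW h0) (dens_gt0 _); first by rewrite invr_gt0.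
  apply: no_x1; exists a => //; apply: (subcube_sub ac).
  by apply: cube_center; rewrite divr_ge0 ?exprn_ge0 ?(ltW h0).
exists x1 => // unpopular; apply: k_popular.
have /nbhs_normP[d /= d0 H_close] :=
  compact_unif_continuous (@compact_cube R n c h) cH delta2.
apply: filterS2 unpopular (near_dyadic_lt h d0) => J + hJ; apply: le_lt_trans.
apply: dens_le => [|a ac /eqP ak]; first exact: ltW.
apply/asboolP => x xa; have ah : cube c h a.
  by apply: (subcube_sub ac); apply: cube_center; rewrite divr_ge0 ?exprn_ge0 ?(ltW h0).
have xa_lt : `|0 - (x - a)| < d by rewrite sub0r normrN; exact: le_lt_trans hJ.
have := H_close _ xa_lt a ah; rewrite (addrC a) subrK => xa_le.
have := color_close a x1 ah x1h (etrans ak (esym x1k)); rewrite mulr1 => ax1_le.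
rewrite -(subrKA (H a)).
by apply: le_trans (ler_normD _ _) _; rewrite [delta]splitr lerD.
Qed.

End PopularValues.

Section OscillationDecay.
Variables (R : realType) (n : nat) (lam Lam : R).
Hypotheses (lam_gt0 : 0 < lam) (Lam_gt0 : 0 < Lam).
Implicit Types (a c e x y z : 'rV[R]_n).
Implicit Types (u : 'rV[R]_n -> R) (H A : 'rV[R]_n -> 'M[R]_n).

Let ratio_gt0 : 0 < 1 + n%:R * Lam / lam.
Proof. by rewrite ltr_pwDl ?divr_ge0 ?mulr_ge0 ?(ltW lam_gt0) ?(ltW Lam_gt0). Qed.

Lemma normal_hessian_gap D u H A (w : R) x1 : normal_hessian lam Lam D u H A ->
  D x1 -> 0 < w -> (exists x y, [/\ D x, D y & w < `|H x - H y|]) ->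
  exists x2 e, [/\ D x2, enorm2 e = 1 &
    w / (4 * (1 + n%:R * Lam / lam)) <= qform (H x2) e - qform (H x1) e].
Proof.
move=> uH Dx1 w0 [y [z [Dy Dz yz]]].
have [x2 Dx2 x2_far] : exists2 x2, D x2 & w / 2 <= `|H x2 - H x1|.
  have [yx1|yx1] := leP (w / 2) `|H y - H x1|; first by exists y.
  exists z => //; have := ler_normB (H y - H x1) (H z - H x1).
  by rewrite opprB addrA subrK; lra.
have [||||||e e1] :=
    @elliptic_positive_direction R n lam Lam (A x1) (H x2 - H x1)
      (w / (4 * (1 + n%:R * Lam / lam))).
- exact: lam_gt0.
- exact: (nh_elliptic uH Dx1).
- by rewrite raddfB /= !(nh_sym uH).
- exact: (nh_normal uH Dx1 Dx2).
- by rewrite divr_gt0 ?mulr_gt0.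
- apply: lt_le_trans x2_far; rewrite invfM mulrA divfK ?lt0r_neq0//; lra.
by rewrite qformD qformN => gap; exists x2, e.
Qed.

Lemma compact_qform_max D H e : D !=set0 -> compact D ->
  (forall x, D x -> {for x, continuous H}) ->
  exists2 x, D x & forall y, D y -> qform (H y) e <= qform (H x) e.
Proof.
move=> D0 cptD cH; pose k := n%:R * enorm2 e + 1.
have k0 : 0 < k by rewrite ltr_wpDl ?mulr_ge0 ?enorm2_ge0.
have cont x : D x -> {for x, continuous (fun y => qform (H y) e)}.
  move=> Dx; apply/(@cvgrPdist_le _ _ _ (nbhs x)) => eps eps0.
  have /cvgrPdist_le/(_ _ (divr_gt0 eps0 k0)) := cH x Dx; apply: filterS => y xy.
  rewrite -qformN -qformD; apply: le_trans (qform_le_norm _ _) _; rewrite -mulrA.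
  apply: le_trans (ler_pM _ _ xy (_ : _ <= k)) _; rewrite ?divfK ?lt0r_neq0//.
  - by rewrite mulr_ge0 ?enorm2_ge0.
  - by rewrite lerDl.
have [|x + xmax] := @compact_EVT_max _ _ (fun y => qform (H y) e) D D0 cptD.
  by apply: continuous_in_subspaceT => x; rewrite inE => /cont.
by rewrite inE => Dx; exists x => // y Dy; apply: xmax; rewrite inE.
Qed.

(* Let [H x'] maximize [qform (H x) e]: were it nearly attained in the small
   cube, the weak Harnack inequality would make the popular value, which lies
   well below it in direction [e], rare. *)
Lemma unit_hessian_value_lost : (0 < n)%N ->
  exists eps theta : R, [/\ 0 < eps, 0 < theta <= 2^-1 & forall u H A,
  normal_hessian lam Lam (cube 0 1) u H A ->
  (forall x y, cube 0 1 x -> cube 0 1 y -> `|H x - H y| <= 1) ->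
  (exists x y, [/\ cube 0 1 x, cube 0 1 y & 2^-1 < `|H x - H y|]) ->
  exists2 x', cube 0 1 x' & forall x, cube 0 theta x -> eps < `|H x - H x'|].
Proof.
move=> n_gt0; have n1 : 1 <= n%:R :> R by rewrite ler1n.
have n0 : 0 < n%:R :> R by rewrite ltr0n.
pose gap := 2^-1 / (4 * (1 + n%:R * Lam / lam)).
have gap0 : 0 < gap by rewrite divr_gt0 ?invr_gt0 ?(mulr_gt0 _ ratio_gt0).
have gap_n : 0 < gap / (4 * n%:R) by rewrite divr_gt0// mulr_gt0.
have [nu nu0 popular] := popular_value n gap_n.
have nu2 : 0 < nu / 2 by rewrite divr_gt0.
have [M M0 harnack] := pure_second_derivative_harnack lam_gt0 Lam_gt0 n_gt0 nu2.
pose t := gap / (4 * M); have t0 : 0 < t by rewrite divr_gt0// mulr_gt0.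
pose h : R := (18 * n%:R)^-1; have h0 : 0 < h by rewrite invr_gt0 mulr_gt0.
have h2 : h <= 2^-1 by rewrite lef_pV2 ?posrE ?mulr_gt0//; lra.
have h1 x : cube 0 h x -> cube 0 1 x by move=> /le_trans; apply; lra.
exists (t / n%:R), h; split=> [||u H A uH osc osc_gt]; [exact: divr_gt0|by rewrite h0|].
apply: contrapT => none_lost.
have attained x' : cube 0 1 x' -> exists2 x, cube 0 h x & `|H x - H x'| <= t / n%:R.
  move=> x'1; apply: contrapT => no_x; apply: none_lost; exists x' => // x xh.
  by rewrite ltNge; apply/negP => ?; apply: no_x; exists x.
have origin : cube 0 1 (0 : 'rV[R]_n) by exact: cube_center.
have [|x /h1 x1|x1 /h1 x11 x1_popular] := popular H 0 h h0.
- by move=> x /h1; exact: (nh_hess_continuous uH).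
- exact: osc.
have [|x2 [e [x21 e1 e_gap]]] := normal_hessian_gap uH x11 _ osc_gt; first by [].
have [|x3 x31 x3_max] := compact_qform_max e _ (@compact_cube R n 0 1) (nh_hess_continuous uH).
  by exists 0.
have [x0 x0h x0_close] := attained x3 x31.
have x0_max : qform (H x3) e - t <= qform (H x0) e.
  by have := qform_dist_le e1 x0_close; rewrite divfK ?lt0r_neq0// ler_norml; lra.
have low := harnack _ _ _ _ _ _ _ uH e1 x3_max t0 x0h x0_max.
apply: x1_popular; apply: filterS low => J low; apply: le_lt_trans (_ : nu / 2 < _); last by lra.
apply: le_trans low; apply: dens_le => [|a _ /asboolP close]; first exact: ltW.
apply/asboolP => x /close /(qform_dist_le e1).
have -> : gap / (4 * n%:R) * n%:R = gap / 4 by field; exact: lt0r_neq0.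
have -> : M * t = gap / 4 by rewrite /t; field; exact: lt0r_neq0.
by have := x3_max x2 x21; move: e_gap; rewrite -/gap ler_norml; lra.
Qed.

Lemma hessian_value_lost :
  exists eps theta : R, [/\ 0 < eps, 0 < theta <= 2^-1 & forall c r w u H A,
  0 < r -> 0 < w -> normal_hessian lam Lam (cube c r) u H A ->
  (forall x y, cube c r x -> cube c r y -> `|H x - H y| <= w) ->
  (exists x y, [/\ cube c r x, cube c r y & w / 2 < `|H x - H y|]) ->
  exists2 x', cube c r x' &
    forall x, cube c (theta * r) x -> eps * w < `|H x - H x'|].
Proof.
have [n0|n_gt0] := posnP n.
  exists 1, 2^-1; split=> [||c r w u H A _ w0 _ _ [x [y [_ _]]]].
  - by [].
  - by rewrite invr_gt0 ltr0n lexx.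
  - have -> : H x - H y = 0.
      by apply/matrixP => i; have := ltn_ord i; rewrite [X in (_ < X)%N]n0.
    by rewrite normr0; lra.
have [eps [th [eps0 thP lost]]] := unit_hessian_value_lost n_gt0.
exists eps, th; split=> // c r w u H A r0 w0 uH osc [y [z [yc zc yz]]].
have inT x : cube c r (c + r *: x) = cube 0 1 x.
  by rewrite -{1}[r]mul1r cube_affine.
have onto x : exists x', c + r *: x' = x by apply: affine_onto; exact: lt0r_neq0.
have rw0 : 0 <= (r ^+ 2 * w)^-1 by rewrite invr_ge0 mulr_ge0 ?sqr_ge0 ?ltW.
have in_cube x : cube 0 1 x -> cube c r (c + r *: x) by rewrite inT.
have uH' := normal_hessian_affine rw0 in_cube uH.
have distE M N : `|(r ^+ 2 * w)^-1 *: (r ^+ 2 *: M) - (r ^+ 2 * w)^-1 *: (r ^+ 2 *: N)|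
    = `|M - N| / w :> R.
  rewrite -!scalerBr scalerA normrZ invfM mulrAC mulVf ?expf_neq0 ?lt0r_neq0// mul1r.
  by rewrite gtr0_norm ?invr_gt0// mulrC.
have [||x' x'1 far] := lost _ _ _ uH'.
- by move=> a b /in_cube a1 /in_cube b1; rewrite distE ler_pdivrMr// mul1r osc.
- have [y' yE] := onto y; have [z' zE] := onto z; exists y', z'.
  by rewrite -!inT distE yE zE; split=> //; rewrite ltr_pdivlMr// mulrC.
exists (c + r *: x') => [|x]; first exact: in_cube.
have [x1 <-] := onto x; rewrite cube_affine// => /far.
by rewrite distE ltr_pdivlMr.
Qed.

Lemma proper_chain_stops (T : finType) (S : nat -> {set T}) :
  (forall k, S k != finset.set0) ->
  exists2 k, (k < #|T|)%N & ~~ (S k.+1 \proper S k).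
Proof.
move=> S_neq0; apply: contrapT => all_proper.
have card_le k : (k <= #|T|)%N -> (#|S k| + k <= #|T|)%N.
  elim: k => [|k IH] kT; first by rewrite addn0 max_card.
  apply: leq_trans (IH (ltnW kT)); rewrite addnS -addSn leq_add2r; apply: proper_card.
  by apply/negPn/negP => stops; apply: all_proper; exists k.
have := card_le _ (leqnn _); rewrite -[leqRHS]add0n leq_add2r leqn0 cards_eq0.
by apply/negP.
Qed.

(* Each time the oscillation fails to halve, the smaller cube attains one
   colour less, so it must halve after as many steps as there are colours. *)
Lemma oscillation_halves :
  exists2 theta : R, 0 < theta <= 2^-1 & forall c r w u H A,
  0 < r -> 0 < w -> normal_hessian lam Lam (cube c r) u H A ->
  (forall x y, cube c r x -> cube c r y -> `|H x - H y| <= w) ->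
  forall x y, cube c (theta * r) x -> cube c (theta * r) y -> `|H x - H y| <= w / 2.
Proof.
have [eps [th [eps0 /andP[th0 th2] lost]]] := hessian_value_lost.
have [T T_neq0 coloring] := finite_coloring n n eps0.
have thk k : 0 < th ^+ k <= 1 by rewrite exprn_gt0//= exprn_ile1 ?(ltW th0)//; lra.
exists (th ^+ #|T|) => [|c r w u H A r0 w0 uH osc].
  have /andP[-> _] := thk #|T|; rewrite -(prednK T_neq0) exprS /=.
  by apply: le_trans th2; have /andP[_ ?] := thk #|T|.-1; rewrite ler_piMr// ltW.
pose radius k := th ^+ k * r.
have radius_gt0 k : 0 < radius k by have /andP[? _] := thk k; exact: mulr_gt0.
have nested k l : (k <= l)%N -> cube c (radius l) `<=` cube c (radius k).
  move=> kl x /le_trans; apply; rewrite ler_pM2r//.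
  by rewrite ler_wiXn2l ?(ltW th0)//; lra.
have in_cube k : cube c (radius k) `<=` cube c r.
  by have := nested 0 k (leq0n k); rewrite /radius expr0 mul1r.
have center k : cube c (radius k) c by exact: cube_center (ltW _).
have [|color color_close] := coloring _ (cube c r) H (H c) w w0.
  by move=> x xc; apply: osc => //; exact: (in_cube 0 _ (center 0)).
pose seen k : {set T} := [set a | `[< exists2 x, cube c (radius k) x & color x = a >]]%SET.
have [k|k kT stops] := @proper_chain_stops T seen.
  apply/set0Pn; exists (color c); rewrite finset.in_set; apply/asboolP.
  by exists c.
suff halved x y : cube c (radius k) x -> cube c (radius k) y -> `|H x - H y| <= w / 2.
  by move=> x y /(nested _ _ (ltnW kT)) xk /(nested _ _ (ltnW kT)) yk; exact: halved.
move=> xk yk; rewrite leNgt; apply/negP => gap; move/negP: stops; apply.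
have [||x' x'k far] := lost c (radius k) w u H A (radius_gt0 k) w0
    (normal_hessian_sub (@in_cube k) uH).
- by move=> a b /in_cube ac /in_cube bc; exact: osc.
- by exists x, y.
apply/properP; split.
  apply/fintype.subsetP => a; rewrite !finset.in_set => /asboolP[z zk <-].
  by apply/asboolP; exists z => //; exact: nested zk.
exists (color x'); rewrite finset.in_set; first by apply/asboolP; exists x'.
apply/asboolPn => -[z zk same]; have := far z; rewrite mulrA -exprS => /(_ zk).
apply/negP; rewrite -leNgt; apply: color_close same; first exact: (in_cube k.+1).
exact: (in_cube k).
Qed.

Lemma geometric_decay_powR (th : R) : 0 < th <= 2^-1 ->
  exists2 alpha, 0 < alpha < 1 & forall d a w : R, 0 < d <= 1 -> 0 <= w ->
  (forall k, d <= th ^+ k -> a <= w / 2 ^+ k) -> a <= 2 * w * d `^ alpha.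
Proof.
move=> /andP[th0 th2]; have ln2 : 0 < ln (2 : R) by rewrite ln_gt0// ltr1n.
have ln_th : ln th <= - ln 2 by rewrite -lnV ?posrE// ler_ln ?posrE// invr_gt0.
have den : 0 < - 2 * ln th by lra.
pose alpha := ln 2 / (- 2 * ln th); have alpha0 : 0 < alpha by rewrite divr_gt0.
have th_alpha : 2^-1 <= th `^ alpha.
  rewrite /powR gt_eqF// -[leLHS]lnK ?posrE ?invr_gt0// ler_expR lnV ?posrE//.
  have -> : alpha * ln th = - (ln 2 / 2).
    by rewrite /alpha; field; rewrite lt_eqF//; lra.
  by lra.
exists alpha => [|d a w /andP[d0 d1] w0 decay].
  by rewrite alpha0 ltr_pdivrMr// mul1r; lra.
have th_lt1 : `|th| < 1 by rewrite gtr0_norm//; lra.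
have /cvgr_lt/(_ _ d0)/filter_ex/ex_minnP[[|k] kd kmin] := cvg_expr th_lt1.
  by move: kd; rewrite expr0 ltNge d1.
have dk : d <= th ^+ k by rewrite leNgt; apply/negP => /kmin; rewrite ltnn.
apply: le_trans (decay k dk) _.
have -> : w / 2 ^+ k = 2 * w * 2^-1 ^+ k.+1.
  by rewrite exprS exprVn; field; rewrite expf_neq0.
rewrite ler_wpM2l ?mulr_ge0//; apply: le_trans (_ : (th `^ alpha) ^+ k.+1 <= _).
  by rewrite lerXn2r ?nnegrE ?powR_ge0 ?invr_ge0.
rewrite -powR_mulrn ?powR_ge0// -powRrM mulrC powRrM powR_mulrn ?(ltW th0)//.
by rewrite ge0_ler_powR ?nnegrE ?exprn_ge0 ?ltW.
Qed.

Lemma hessian_holder : exists2 alpha : R, 0 < alpha < 1 & forall c r w u H A,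
  0 < r -> 0 < w -> normal_hessian lam Lam (cube c r) u H A ->
  (forall x y, cube c r x -> cube c r y -> `|H x - H y| <= w) ->
  forall x, cube c r x -> `|H x - H c| <= 2 * w * (`|x - c| / r) `^ alpha.
Proof.
have [th th_itv halves] := oscillation_halves.
have [alpha alpha_itv decay] := geometric_decay_powR th_itv.
exists alpha => // c r w u H A r0 w0 uH osc x xc.
have [->|x_neq_c] := eqVneq x c.
  by rewrite subrr normr0 mulr_ge0 ?powR_ge0 ?mulr_ge0 ?ltW.
have /andP[th0 th2] := th_itv; have radius_gt0 k : 0 < th ^+ k * r.
  by rewrite mulr_gt0 ?exprn_gt0.
have osc_le k : forall y z, cube c (th ^+ k * r) y -> cube c (th ^+ k * r) z ->
    `|H y - H z| <= w / 2 ^+ k.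
  elim: k => [|k IH]; first by rewrite expr0 mul1r divr1.
  have -> : th ^+ k.+1 * r = th * (th ^+ k * r) by rewrite exprS mulrA.
  have -> : w / 2 ^+ k.+1 = w / 2 ^+ k / 2 by rewrite exprSr invfM mulrA.
  apply: halves IH => //; first by rewrite divr_gt0 ?exprn_gt0.
  apply: normal_hessian_sub uH => y /le_trans; apply.
  by rewrite ler_piMl ?exprn_ile1 ?ltW//; lra.
apply: decay => [||k d_le]; [|exact: ltW|].
  by rewrite divr_gt0 ?normr_gt0 ?subr_eq0//= ler_pdivrMr// mul1r.
apply: osc_le; first by rewrite /cube /= -ler_pdivrMr.
by apply: cube_center; exact: ltW.
Qed.

End OscillationDecay.

Section Balls.
Variables (R : realType) (n : nat).
Implicit Types (c x y : 'rV[R]_n).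

Lemma enormD_le x y : enorm (x + y) <= enorm x + enorm y.
Proof.
rewrite -(@ler_pXn2r _ 2) ?nnegrE ?addr_ge0 ?sqrtr_ge0// sqr_sqrtr ?enorm2_ge0//.
rewrite sqrrD !sqr_sqrtr ?enorm2_ge0// enorm2D lerD2r lerD2l mulr_natl ler_pMn2r//.
apply: le_trans (ler_norm _) _; rewrite -(@ler_pXn2r _ 2) ?nnegrE ?mulr_ge0 ?sqrtr_ge0//.
by rewrite real_normK ?num_real// exprMn !sqr_sqrtr ?enorm2_ge0// cauchy_schwarz.
Qed.

Lemma enorm_le_norm x : enorm x <= n%:R * `|x|.
Proof.
rewrite -(@ler_pXn2r _ 2) ?nnegrE ?mulr_ge0 ?sqrtr_ge0// sqr_sqrtr ?enorm2_ge0//.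
apply: le_trans (enorm2_le_norm x) _; rewrite exprMn ler_wpM2r ?sqr_ge0//.
by rewrite -natrX ler_nat; case: (n) => // k; rewrite -mulnn leq_pmulr.
Qed.

Lemma enorm_scale_delta (t : R) i : enorm (t *: (delta_mx ord0 i : 'rV[R]_n)) = `|t|.
Proof. by rewrite /enorm enorm2Z enorm2_delta mulr1 sqrtr_sqr. Qed.

Lemma open_eball (r : R) : open (@eball R n r).
Proof.
apply: (@open_comp _ _ (@enorm R n) [set y | y < r]) => [x _|]; last exact: open_lt.
exact: (continuous_comp (@enorm2_continuous R n x) (@sqrt_continuous R _)).
Qed.

Lemma compact_cball (r : R) : 0 <= r -> compact (@cball R n r).
Proof.
move=> r0; rewrite (_ : cball r = [set x | enorm2 x <= r ^+ 2]).
  exact: compact_enorm2_le.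
apply/seteqP; split=> x /=; rewrite /cball /= -(@ler_pXn2r _ 2 _ (enorm x)) ?nnegrE ?sqrtr_ge0//;
  by rewrite sqr_sqrtr ?enorm2_ge0.
Qed.

Lemma subset_eball (r s : R) : r <= s -> @eball R n r `<=` eball s.
Proof. by move=> rs x xr; exact: lt_le_trans rs. Qed.

Lemma sub_cball_eball (r s : R) : r < s -> @cball R n r `<=` eball s.
Proof. by move=> rs x xr; exact: le_lt_trans rs. Qed.

Lemma sub_cball (r s : R) : r <= s -> @cball R n r `<=` cball s.
Proof. by move=> rs x xr; exact: le_trans rs. Qed.

Lemma cball0 (r : R) : 0 <= r -> cball r (0 : 'rV[R]_n).
Proof. by rewrite /cball /= /enorm enorm2_0 sqrtr0. Qed.

Lemma cube_sub_cball x (r d : R) : 0 <= d -> cball r x ->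
  cube x (d / n.+1%:R) `<=` cball (r + d).
Proof.
move=> d0 xr y yx; rewrite /cball /= -(subrK x y) addrC.
apply: le_trans (enormD_le _ _) _; apply: lerD xr _; apply: le_trans (enorm_le_norm _) _.
apply: le_trans (ler_wpM2l (ler0n _ n) yx) _.
by rewrite mulrCA ler_piMr// ler_pdivrMr// mul1r ler_nat.
Qed.

End Balls.

Section Calculus.
Variables (R : realType) (p q : nat).
Implicit Types (f : 'M[R]_(p, q) -> R) (x z : 'M[R]_(p, q)).

Lemma derive_sum_pd f x z : differentiable f x ->
  'D_z f x = \sum_i \sum_j z i j * pd f i j x.
Proof.
move=> df; rewrite deriveE// {1}(matrix_sum_delta z) raddf_sum /=.
apply: eq_bigr => i _; rewrite raddf_sum /=; apply: eq_bigr => j _.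
by rewrite linearZ /= /pd deriveE.
Qed.

Lemma derive_ge0 f x z : derivable f x z ->
  (\forall h \near (0 : R)^'+, f x <= f (h *: z + x)) -> 0 <= 'D_z f x.
Proof.
move=> /cvg_dnbhs_at_right der f_ge; rewrite leNgt; apply/negP => neg.
have /cvgr_lt/(_ _ neg) quotient_lt := der.
have [h [f_geh [h0]]] := filter_ex (filterI f_ge (filterI (nbhs_right_gt 0) quotient_lt)).
by rewrite ltNge mulr_ge0 ?invr_ge0 ?subr_ge0 ?(ltW h0).
Qed.

Lemma derive_norm_le f x z (K : R) : derivable f x z ->
  (\forall h \near (0 : R)^', `|f (h *: z + x) - f x| <= K * `|h|) -> `|'D_z f x| <= K.
Proof.
move=> der f_le; rewrite leNgt; apply/negP => big.
have /cvgr_norm_gt/(_ _ big) quotient_gt := der.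
have [h [f_leh [h0]]] := filter_ex (filterI f_le (filterI (nbhs_dnbhs_neq 0) quotient_gt)).
by rewrite ltNge normrM normfV ler_pdivrMl ?normr_gt0// mulrC f_leh.
Qed.

End Calculus.

Section ClassC2.
Variables (R : realType) (n : nat) (U : set 'rV[R]_n) (u : 'rV[R]_n -> R).
Hypotheses (openU : open U) (u_C2 : C2_on U u).
Implicit Types (x z : 'rV[R]_n).

Definition gradient x : 'rV[R]_n := \row_i du u i x.

Lemma C2_has_hessian : has_hessian U u gradient (hess u).
Proof.
have [diff_u diff_du _] := u_C2; move=> x Ux z; split=> [|a].
  apply: DeriveDef; first by apply: diff_derivable; exact: diff_u.
  rewrite derive_sum_pd ?big_ord1; last exact: diff_u.
  by rewrite dotE; apply: eq_bigr => i _; rewrite mxE mulrC.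
have der_du i : is_derive x z (du u i) (\sum_j z ord0 j * ddu u j i x).
  apply: DeriveDef; first by apply: diff_derivable; exact: diff_du.
  by rewrite derive_sum_pd ?big_ord1//; exact: diff_du.
have -> : (fun y => dot (gradient y) a) = \sum_(i < n) a ord0 i *: du u i.
  by apply/funext => y; rewrite fct_sumE dotE; apply: eq_bigr => i _; rewrite mxE mulrC.
apply: is_derive_eq; rewrite bformE exchange_big; apply: eq_bigr => i _.
by rewrite -[LHS]/(_ * _) mulr_sumr; apply: eq_bigr => j _; rewrite mxE; ring.
Qed.

Lemma C2_continuous x : U x -> {for x, continuous u}.
Proof. by case: u_C2 => diff_u _ _ /diff_u; exact: differentiable_continuous. Qed.

Lemma C2_hess_continuous x : U x -> {for x, continuous (hess u)}.
Proof.
move=> Ux; apply: mx_continuous => i j; have [_ _ /(_ ord0 j ord0 i)] := u_C2.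
rewrite continuous_open_subspace// => /(_ x); rewrite inE => /(_ Ux).
by rewrite (_ : (fun y => hess u y i j) = ddu u i j)//; apply/funext => y; rewrite mxE.
Qed.

Lemma C2_hess_sym x : U x -> (hess u x)^T = hess u x.
Proof. move=> Ux; exact: hessian_sym C2_has_hessian openU Ux (C2_hess_continuous Ux). Qed.

Lemma C2_unif_hessian D : compact D -> D `<=` U -> unif_hessian D u (hess u).
Proof.
move=> cptD DU; apply: (has_hessian_unif C2_has_hessian openU cptD DU) => x /DU.
exact: C2_hess_continuous.
Qed.

Lemma C11_hess_le (V A : set 'rV[R]_n) (K : R) x : C11_bound u A K ->
  open V -> V `<=` A -> V `<=` U -> V x -> `|hess u x| <= K.
Proof.
move=> [u_le _ lip] openV VA VU Vx; have K0 := le_trans (normr_ge0 _) (u_le _ (VA _ Vx)).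
apply: mx_norm_le => // i j; rewrite mxE.
have [_ diff_du _] := u_C2; apply: derive_norm_le.
  by apply: diff_derivable; exact: diff_du _ (VU _ Vx).
have shift0 : h *: delta_mx ord0 i + x @[h --> (0 : R)] --> x.
  rewrite -[X in _ --> X]add0r -(scale0r (delta_mx ord0 i)).
  exact: cvgD (@scalel_continuous _ _ _ _) (cvg_cst x).
have inV : \forall h \near (0 : R), V (h *: delta_mx ord0 i + x).
  exact: shift0 _ (open_nbhs_nbhs (conj openV Vx)).
apply: filterS (nbhs_dnbhs inV) => h Vh; apply: le_trans (lip j _ _ (VA _ Vh) (VA _ Vx)) _.
by rewrite addrK enorm_scale_delta.
Qed.

Lemma C2alpha_bound_hess (A B : set 'rV[R]_n) (K L r alpha : R) :
  0 < r -> 0 <= alpha -> 0 <= K -> 0 <= L -> A `<=` B -> C11_bound u B K ->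
  (forall x, A x -> `|hess u x| <= K) ->
  (forall x y, A x -> A y -> `|hess u x - hess u y| <= L * (`|x - y| / r) `^ alpha) ->
  C2alpha_bound u A alpha (K + L * r^-1 `^ alpha).
Proof.
move=> r0 alpha0 K0 L0 AB [u_le du_le _] hess_le holder.
have K_le : K <= K + L * r^-1 `^ alpha by rewrite lerDl mulr_ge0 ?powR_ge0.
split=> [x Ax|i x Ax|i j x Ax|i j x y Ax Ay].
- exact: le_trans (u_le x (AB x Ax)) K_le.
- exact: le_trans (du_le i x (AB x Ax)) K_le.
- apply: le_trans (le_trans (hess_le x Ax) K_le).
  by have := mx_coord_le_norm (hess u x) i j; rewrite mxE.
- have := mx_coord_le_norm (hess u x - hess u y) i j; rewrite !mxE => /le_trans; apply.
  apply: le_trans (holder x y Ax Ay) _.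
  apply: (@le_trans _ _ (L * (enorm (x - y) / r) `^ alpha)).
    rewrite ler_wpM2l// ge0_ler_powR ?nnegrE ?divr_ge0 ?sqrtr_ge0 ?(ltW r0)//.
    by rewrite ler_pM2r ?invr_gt0// norm_le_enorm.
  by rewrite powRM ?sqrtr_ge0 ?invr_ge0 ?(ltW r0)// mulrCA mulrC ler_wpM2r ?powR_ge0// lerDr.
Qed.

End ClassC2.

Section EllipticEquation.
Variables (R : realType) (n : nat) (lam Lam : R) (F : 'M[R]_n -> R).
Hypotheses (F_C2 : C2_on setT (symmetrize F)) (F_quasi : quasiconcave F).

Definition symgrad (M : 'M[R]_n) : 'M[R]_n := \matrix_(i, j) pd (symmetrize F) i j M.

Lemma symmetrize_sym (M : 'M[R]_n) : M^T = M -> symmetrize F M = F M.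
Proof.
by rewrite /symmetrize => ->; rewrite -[M + M]mulr2n -[M *+ 2]scaler_nat scalerA mulVf// scale1r.
Qed.

Lemma unif_elliptic_symgrad (M : 'M[R]_n) : unif_elliptic lam Lam F -> M^T = M ->
  elliptic lam Lam (symgrad M).
Proof.
move=> ellF symM z; have [le_q q_le] := ellF M z symM.
have -> : qform (symgrad M) z
    = \sum_i \sum_j pd (symmetrize F) i j M * z ord0 i * z ord0 j.
  by rewrite /qform bformE; do 2 (apply: eq_bigr => ? _); rewrite mxE.
by apply/andP.
Qed.

(* [N - M] points into the convex set [F >= F M]. *)
Lemma quasiconcave_symgrad (M N : 'M[R]_n) : M^T = M -> N^T = N -> F M <= F N ->
  0 <= mxdot (symgrad M) (N - M).
Proof.
move=> symM symN FMN; have [dF _ _] := F_C2.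
have -> : mxdot (symgrad M) (N - M) = 'D_(N - M) (symmetrize F) M.
  rewrite derive_sum_pd; last exact: dF.
  by rewrite mxdotE; do 2 (apply: eq_bigr => ? _); rewrite mxE mulrC.
apply: derive_ge0; first by apply: diff_derivable; exact: dF.
apply: filterS2 (nbhs_right_gt 0) (nbhs_right_le ltr01) => h h0 h1.
have -> : h *: (N - M) + M = h *: N + (1 - h) *: M.
  by rewrite scalerBr scalerBl scale1r addrAC addrA.
rewrite !symmetrize_sym//; last by rewrite raddfD /= !linearZ /= symM symN.
by have := F_quasi symN symM; rewrite (min_idPr FMN) => /(_ h); rewrite (ltW h0) h1; apply.
Qed.

Lemma solution_normal_hessian (U D : set 'rV[R]_n) (u : 'rV[R]_n -> R) :
  unif_elliptic lam Lam F -> open U -> C2_on U u ->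
  (forall x, U x -> F (hess u x) = 0) -> compact D -> D `<=` U ->
  normal_hessian lam Lam D u (hess u) (symgrad \o hess u).
Proof.
move=> ellF openU u_C2 Fu cptD DU.
have symH x : U x -> (hess u x)^T = hess u x by exact: C2_hess_sym.
split=> [x /DU|x /DU||x /DU|x /DU Ux|x y /DU Ux /DU Uy].
- exact: C2_continuous.
- exact: C2_hess_continuous.
- exact: (C2_unif_hessian openU u_C2 cptD DU).
- exact: symH.
- exact: unif_elliptic_symgrad (symH x Ux).
- apply: quasiconcave_symgrad (symH x Ux) (symH y Uy) _.
  by rewrite le_eqVlt; apply/orP; left; apply/eqP; exact: etrans (Fu x Ux) (esym (Fu y Uy)).
Qed.

End EllipticEquation.

Lemma interior_hessian_holder (R : realType) (n : nat) (lam Lam : R) :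
  0 < lam -> 0 < Lam ->
  exists2 alpha : R, 0 < alpha < 1 & forall (D E : set 'rV[R]_n) r w u H A,
  0 < r -> 0 < w -> normal_hessian lam Lam D u H A ->
  (forall x, D x -> `|H x| <= w) -> (forall x, E x -> cube x r `<=` D) ->
  forall x y, E x -> E y -> `|H x - H y| <= 4 * w * (`|x - y| / r) `^ alpha.
Proof.
move=> lam_gt0 Lam_gt0; have [alpha alpha_itv holder] := hessian_holder n lam_gt0 Lam_gt0.
exists alpha => // D E r w u H A r0 w0 uH H_le ED x y Ex Ey.
have osc a b : D a -> D b -> `|H a - H b| <= 2 * w.
  by move=> /H_le a_le /H_le b_le; apply: le_trans (ler_normB _ _) _; lra.
have w2 : 0 < 2 * w by rewrite mulr_gt0.
have -> : 4 * w = 2 * (2 * w) by ring.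
have [near|far] := leP `|x - y| r.
  apply: (holder _ _ _ _ _ _ r0 w2 (normal_hessian_sub (ED y Ey) uH)) => // a b ay by_.
  by apply: osc; exact: ED Ey _ _.
have inD z : E z -> D z by move=> Ez; apply: (ED z Ez); apply: cube_center; exact: ltW.
apply: le_trans (osc _ _ (inD x Ex) (inD y Ey)) _.
have : 1 <= (`|x - y| / r) `^ alpha.
  have /andP[alpha0 _] := alpha_itv; rewrite -(powRr0 (`|x - y| / r)) ler_powR ?(ltW alpha0)//.
  by rewrite ler_pdivlMr// mul1r ltW.
by move=> /(ler_wpM2l (ltW w2)); lra.
Qed.

Theorem theorem3p1 (R : realType) (n : nat) (lam Lam : R) :
  0 < lam -> lam <= Lam ->
  exists alpha : R, 0 < alpha < 1 /\
  forall K : R, exists C : R,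
  forall (F : 'M[R]_n -> R) (u : 'rV[R]_n -> R),
    C2_on setT (symmetrize F) ->
    quasiconcave F ->
    F 0 = 0 ->
    unif_elliptic lam Lam F ->
    C2_on (eball 1) u ->
    (forall x, eball 1 x -> F (hess u x) = 0) ->
    C11_bound u (cball (3 / 4)) K ->
    C2alpha_bound u (cball (1 / 2)) alpha C.
Proof.
move=> lam_gt0 lam_le; have Lam_gt0 := lt_le_trans lam_gt0 lam_le.
have [alpha alpha_itv holder] := interior_hessian_holder n lam_gt0 Lam_gt0.
exists alpha; split=> // K; pose r : R := 8^-1 / n.+1%:R; pose L := 4 * (K + 1).
pose D := @cball R n (1 / 2 + 8^-1).
exists (K + L * r^-1 `^ alpha) => F u F_C2 F_quasi _ F_ell u_C2 Fu u_C11.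
have K_ge0 : 0 <= K.
  by have [u_le _ _] := u_C11; apply: le_trans (normr_ge0 _) (u_le 0 _); apply: cball0; lra.
have r_gt0 : 0 < r by rewrite divr_gt0.
have cubes x : cball (1 / 2) x -> cube x r `<=` D by apply: cube_sub_cball.
have hess_le x : D x -> `|hess u x| <= K.
  move=> x_le; apply: (C11_hess_le u_C2 u_C11 (@open_eball R n (3 / 4))) => [y|y|].
  - by move=> /ltW.
  - by apply: subset_eball; lra.
  - by apply: sub_cball_eball x_le; lra.
have solution : normal_hessian lam Lam D u (hess u) (symgrad F \o hess u).
  apply: (solution_normal_hessian F_C2 F_quasi F_ell (@open_eball R n 1) u_C2 Fu).
  - by apply: compact_cball; lra.
  - by apply: sub_cball_eball; lra.
apply: (C2alpha_bound_hess r_gt0 _ K_ge0 _ _ u_C11) => [| | |x x_le|x y x_le y_le].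
- by case/andP: alpha_itv => /ltW.
- by rewrite /L; lra.
- by apply: sub_cball; lra.
- by apply: hess_le; apply: sub_cball x_le; lra.
- apply: (holder _ _ _ _ _ _ _ r_gt0 _ solution _ cubes) => //; first by lra.
  by move=> z /hess_le z_le; lra.
Qed.
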